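(* Let $\mathcal{M}$ be a complete Riemannian manifold, $\mathcal{E}$ a Euclidean space, $\varphi\colon\mathcal{M}\to\mathcal{E}$ a smooth map, and $\mathcal{X}=\varphi(\mathcal{M})$. Let $\Phi\colon\mathcal{M}\to\mathcal{M}$ be a rebalancing map with respect to $\varphi$, let $f$ be a three times continuously differentiable real-valued function on a neighborhood of $\mathcal{X}$ in $\mathcal{E}$, let $x_0\in\mathcal{X}$, and assume the sublevel set $\{x\in\mathcal{X}:f(x)\leq f(x_0)\}$ is bounded. Then any sequence $(y_k)_{k\geq0}$ produced by the hooked Riemannian trust-region algorithm (described in the context) applied to $g=f\circ\varphi$ with hook $\Phi$ and input $y_0\in\varphi^{-1}(x_0)$ admits at least one accumulation point, and any such point is 2-critical for $\min_{y\in\mathcal{M}}g(y)$.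
   Context: A map $\Phi\colon\mathcal{M}\to\mathcal{M}$ (not necessarily continuous) is a rebalancing map with respect to $\varphi$ if (a) $\varphi\circ\Phi=\varphi$, and (b) $\Phi(\varphi^{-1}(B))$ is bounded for all bounded $B\subseteq\mathcal{X}$ (boundedness with respect to Riemannian and Euclidean distances respectively). A point $y\in\mathcal{M}$ is 2-critical for $g$ if for all smooth curves $c\colon\mathbb{R}\to\mathcal{M}$ with $c(0)=y$ one has $(g\circ c)'(0)=0$ and $(g\circ c)''(0)\geq0$; equivalently, the Riemannian gradient $\nabla g(y)$ is zero and the Riemannian Hessian $\nabla^2g(y)$ is positive semidefinite. Algorithm. A retraction $\mathrm{R}\colon\mathrm{T}\mathcal{M}\to\mathcal{M}$ is fixed: a smooth map such that $c(t)=\mathrm{R}_y(tu)$ satisfies $c(0)=y$, $c'(0)=u$. Parameters: $\gamma_c,\eta\in(0,1)$, $0<\underline{\gamma}\leq\overline{\gamma}<\infty$. Input: $y_0\in\mathcal{M}$, $\gamma_0\in[\underline\gamma,\overline\gamma]$. First replace $y_0$ by $\Phi(y_0)$. At iteration $k=0,1,2,\dots$: let $\hat g_k=g\circ\mathrm{R}_{y_k}\colon\mathrm{T}_{y_k}\mathcal{M}\to\mathbb{R}$, let $m_k(s)=g(y_k)+\langle s,\nabla\hat g_k(0)\rangle+\frac12\langle s,\nabla^2\hat g_k(0)[s]\rangle$ (note $\nabla\hat g_k(0)=\nabla g(y_k)$), let $\lambda_k$ be the least eigenvalue of $\nabla^2\hat g_k(0)$ and $(\lambda_k)_-=\min(\lambda_k,0)$.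 (i) If $\lambda_k<0$ and $\|\nabla g(y_k)\|^2<|(\lambda_k)_-|^3$, set $\delta_k=\gamma_k|(\lambda_k)_-|$ and $u_k=e_k$, where $e_k$ is a unit-norm eigenvector of $\nabla^2\hat g_k(0)$ for $\lambda_k$ with sign such that $\langle e_k,\nabla g(y_k)\rangle\leq0$; otherwise set $\delta_k=\gamma_k\|\nabla g(y_k)\|$ and $u_k=-\nabla g(y_k)$. (ii) Let $s_k^c=t_ku_k$ with $t_k$ a minimizer of $m_k(tu_k)$ over $t\geq0$ subject to $\|tu_k\|\leq\delta_k$. Choose any $s_k\in\mathrm{T}_{y_k}\mathcal{M}$ with $\|s_k\|\leq\delta_k$ and $m_k(s_k)\leq m_k(s_k^c)$. (iii) Let $\rho_k=\frac{g(y_k)-g(\mathrm{R}_{y_k}(s_k))}{m_k(0)-m_k(s_k)}$ (set $\rho_k=1$ if the denominator is zero). (iv) If $\rho_k\geq\eta$, set $y_{k+1}=\Phi(\mathrm{R}_{y_k}(s_k))$ and choose any $\gamma_{k+1}\in[\underline\gamma,\overline\gamma]$; otherwise set $y_{k+1}=y_k$ and $\gamma_{k+1}=\gamma_c\gamma_k$. *)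

(* Defs.v *)
From HB Require Import structures.
From mathcomp Require Import all_boot all_order all_algebra.
From mathcomp Require Import all_classical all_reals all_analysis.
Set Implicit Arguments.
Unset Strict Implicit.
Unset Printing Implicit Defensive.
Import Order.TTheory GRing.Theory Num.Theory.
Import numFieldNormedType.Exports.
Local Open Scope classical_set_scope.
Local Open Scope ring_scope.

(* Only used for open [U] and finite-dimensional [V], where "differentiable
   with C^k directional derivatives" is the usual C^(k+1). *)
Fixpoint Ck_on (R : realType) (V W : normedModType R) (k : nat) (U : set V)
    (f : V -> W) : Prop :=
  if k is k'.+1 then
    (forall x, U x -> differentiable f x) /\
    (forall v, Ck_on k' U (fun x => 'D_v f x))
  else forall x, U x -> {for x, continuous f}.

Definition smooth_on (R : realType) (V W : normedModType R) (U : set V)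
    (f : V -> W) : Prop := forall k, Ck_on k U f.

(* [cinv] is only meaningful on the open set [coord @` dom]. *)
Record chart (R : realType) (n : nat) (M : topologicalType) := Chart {
  dom : set M;
  coord : M -> 'rV[R]_n;
  cinv : 'rV[R]_n -> M;
  dom_open : open dom;
  img_open : open (coord @` dom);
  coordK : forall y, dom y -> cinv (coord y) = y;
  coord_cont : forall y, dom y -> {for y, continuous coord};
  cinv_cont : forall x, (coord @` dom) x -> {for x, continuous cinv} }.

Definition img (R : realType) (n : nat) (M : topologicalType)
  (c : chart R n M) : set 'rV[R]_n := coord c @` dom c.

(* Smooth n-manifold. The preferred chart [chart_at y] serves to represent the
   tangent space at [y]: T_y M is 'rV[R]_n, a vector being given by its
   components in [chart_at y]. *)
Record manifold (R : realType) (n : nat) := Manifold {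
  carrier :> topologicalType;
  atlas : set (chart R n carrier);
  chart_at : carrier -> chart R n carrier;
  chart_at_atlas : forall y, atlas (chart_at y);
  chart_at_dom : forall y, dom (chart_at y) y;
  transition_smooth : forall c d, atlas c -> atlas d ->
    smooth_on (coord c @` (dom c `&` dom d)) (coord d \o cinv c);
  manifold_hausdorff : hausdorff_space carrier;
  manifold_second_countable : @second_countable carrier }.

Arguments atlas {R n} m.

(* The tangent vector at [y] whose components in the chart [c] are [v]. *)
Definition tvec (R : realType) (n : nat) (M : manifold R n)
    (c : chart R n M) (y : M) (v : 'rV[R]_n) : 'rV[R]_n :=
  'D_v (coord (chart_at y) \o cinv c) (coord c y).

(* Smooth map out of a manifold into a vector space. *)
Definition smooth_from (R : realType) (n : nat) (M : manifold R n)
    (W : normedModType R) (h : M -> W) : Prop :=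
  forall c, atlas M c -> smooth_on (img c) (h \o cinv c).

(* Smooth map from an open set [U] of a vector space into a manifold. *)
Definition smooth_into (R : realType) (n : nat) (M : manifold R n)
    (V : normedModType R) (U : set V) (h : V -> M) : Prop :=
  (forall x, U x -> {for x, continuous h}) /\
  (forall d, atlas M d ->
     smooth_on (U `&` h @^-1` dom d) (coord d \o h)).

Definition velocity (R : realType) (n : nat) (M : manifold R n)
    (c : R -> M) (t : R) : 'rV[R]_n :=
  derive1 (coord (chart_at (c t)) \o c) t.

Record riemannian_metric (R : realType) (n : nat) (M : manifold R n) :=
  RiemannianMetric {
  inner :> M -> 'rV[R]_n -> 'rV[R]_n -> R;
  inner_sym : forall y u v, inner y u v = inner y v u;
  inner_linear : forall y a u v w,
    inner y (a *: u + v) w = a * inner y u w + inner y v w;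
  inner_pos : forall y u, u != 0 -> 0 < inner y u u;
  inner_smooth : forall c, atlas M c -> forall v w,
    @smooth_on R 'rV[R]_n R^o (img c) (fun x =>
      inner (cinv c x) (tvec c (cinv c x) v) (tvec c (cinv c x) w)) }.

Definition rnorm (R : realType) (n : nat) (M : manifold R n)
  (G : riemannian_metric M) (y : M) (u : 'rV[R]_n) : R :=
  Num.sqrt (G y u u).

(* [curve_length G p q L]: some piecewise smooth curve from [p] to [q] has
   length [L]; the curve is presented as a finite chain of smooth segments. *)
Inductive curve_length (R : realType) (n : nat) (M : manifold R n)
    (G : riemannian_metric M) : M -> M -> \bar R -> Prop :=
| curve_length_nil p : curve_length G p p 0%E
| curve_length_cons (c : R -> M) (a b : R) (O : set R^o) (q : M) (L : \bar R) :
    a <= b -> open O -> `[a, b]%classic `<=` O ->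
    @smooth_into R n M R^o O c ->
    curve_length G (c b) q L ->
    curve_length G (c a) q
      (\int[lebesgue_measure]_(t in `[a, b]) (rnorm G (c t) (velocity c t))%:E
       + L)%E.

(* Equal to +oo between distinct connected components. *)
Definition rdist (R : realType) (n : nat) (M : manifold R n)
    (G : riemannian_metric M) (p q : M) : \bar R :=
  ereal_inf [set L | curve_length G p q L].

Definition rbounded (R : realType) (n : nat) (M : manifold R n)
    (G : riemannian_metric M) (A : set M) : Prop :=
  exists C : R, forall p q, A p -> A q -> (rdist G p q <= C%:E)%E.

Definition rcomplete (R : realType) (n : nat) (M : manifold R n)
    (G : riemannian_metric M) : Prop :=
  forall u : nat -> M,
    (forall e : R, 0 < e -> exists N, forall i j, (N <= i)%N -> (N <= j)%N ->
       (rdist G (u i) (u j) < e%:E)%E) ->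
    exists p, forall e : R, 0 < e -> exists N, forall i, (N <= i)%N ->
       (rdist G (u i) p < e%:E)%E.

(* Boundedness for the Euclidean norm (the library norm on 'rV[R]_m is the
   sup norm). *)
Definition ebounded (R : realType) (m : nat) (B : set 'rV[R]_m) : Prop :=
  exists C : R, forall x, B x -> Num.sqrt (\sum_i x 0 i ^+ 2) <= C.

Definition rebalancing (R : realType) (n m : nat) (M : manifold R n)
    (G : riemannian_metric M) (phi : M -> 'rV[R]_m) (Phi : M -> M) : Prop :=
  (forall y, phi (Phi y) = phi y) /\
  (forall B : set 'rV[R]_m, B `<=` range phi -> ebounded B ->
     rbounded G (Phi @` (phi @^-1` B))).

(* A retraction, as a family of maps [ret y : T_y M -> M]; smoothness on the
   tangent bundle is read in the bundle charts induced by the atlas. *)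
Record retraction (R : realType) (n : nat) (M : manifold R n) := Retraction {
  ret :> M -> 'rV[R]_n -> M;
  ret_smooth : forall c, atlas M c ->
    @smooth_into R n M ('rV[R]_n * 'rV[R]_n)%type (img c `*` setT)
      (fun xv => ret (cinv c xv.1) (tvec c (cinv c xv.1) xv.2));
  ret_zero : forall y, ret y 0 = y;
  ret_velocity : forall y u, velocity (fun t : R => ret y (t *: u)) 0 = u }.

Definition two_critical (R : realType) (n : nat) (M : manifold R n)
    (g : M -> R) (y : M) : Prop :=
  forall c : R -> M, @smooth_into R n M R^o setT c -> c 0 = y ->
    derive1 (g \o c) 0 = 0 /\ 0 <= derive1n 2 (g \o c) 0.

(* Gradient and Hessian, with respect to an inner product [ip] on 'rV[R]_n.
   [xget 0] selects the unique vector with the defining property (such a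
   vector exists whenever [h] is C^1, resp. C^2, near [x]). *)
Definition gradient (R : realType) (n : nat)
    (ip : 'rV[R]_n -> 'rV[R]_n -> R) (h : 'rV[R]_n -> R^o)
    (x : 'rV[R]_n) : 'rV[R]_n :=
  xget 0 [set v | forall w, ip v w = 'D_w h x].

Definition hessian (R : realType) (n : nat)
    (ip : 'rV[R]_n -> 'rV[R]_n -> R) (h : 'rV[R]_n -> R^o)
    (x s : 'rV[R]_n) : 'rV[R]_n :=
  xget 0 [set v | forall w,
    ip v w = 'D_s (fun z => 'D_w h z : R^o) x].

Definition eigenval (R : realType) (n : nat) (H : 'rV[R]_n -> 'rV[R]_n)
    (l : R) : Prop := exists2 e, e != 0 & H e = l *: e.

(* Equal to 0 by convention in dimension 0, where there are no eigenvalues. *)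
Definition least_eigenval (R : realType) (n : nat)
    (H : 'rV[R]_n -> 'rV[R]_n) : R :=
  xget 0 [set l | eigenval H l /\ forall l', eigenval H l' -> l <= l'].

Section TrustRegion.
Context (R : realType) (n : nat) (M : manifold R n).
Context (G : riemannian_metric M) (Rt : retraction M) (g : M -> R).

Definition rgrad (y : M) : 'rV[R]_n :=
  gradient (G y) (g \o cinv (chart_at y)) (coord (chart_at y) y).

Definition pull_grad (y : M) : 'rV[R]_n := gradient (G y) (g \o Rt y) 0.

Definition pull_hess (y : M) : 'rV[R]_n -> 'rV[R]_n :=
  hessian (G y) (g \o Rt y) 0.

Definition model (y : M) (s : 'rV[R]_n) : R :=
  g y + G y s (pull_grad y) + 2^-1 * G y s (pull_hess y s).

Definition lambda_min (y : M) : R := least_eigenval (pull_hess y).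

Definition lambda_neg (y : M) : R := Num.min (lambda_min y) 0.

Definition radius_direction (y : M) (gam delta : R) (u : 'rV[R]_n) : Prop :=
  if (lambda_min y < 0) && (rnorm G y (rgrad y) ^+ 2 < `|lambda_neg y| ^+ 3)
  then [/\ delta = gam * `|lambda_neg y|, rnorm G y u = 1,
           pull_hess y u = lambda_min y *: u & G y u (rgrad y) <= 0]
  else delta = gam * rnorm G y (rgrad y) /\ u = - rgrad y.

Definition cauchy_step (y : M) (delta : R) (u sc : 'rV[R]_n) : Prop :=
  exists t : R, [/\ 0 <= t, rnorm G y (t *: u) <= delta,
    (forall t' : R, 0 <= t' -> rnorm G y (t' *: u) <= delta ->
       model y (t *: u) <= model y (t' *: u))
    & sc = t *: u].

Definition admissible_step (y : M) (gam : R) (s : 'rV[R]_n) : Prop :=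
  exists delta u sc, [/\ radius_direction y gam delta u,
    cauchy_step y delta u sc, rnorm G y s <= delta
    & model y s <= model y sc].

Definition rho (y : M) (s : 'rV[R]_n) : R :=
  if model y 0 - model y s == 0 then 1
  else (g y - g (Rt y s)) / (model y 0 - model y s).

(* The sequences of iterates [y] and of radius parameters [gam] form a run of
   the algorithm with hook [Phi] from the input [yin]. *)
Definition hooked_rtr_run (Phi : M -> M) (gamc eta gamlo gamhi : R)
    (yin : M) (y : nat -> M) (gam : nat -> R) : Prop :=
  [/\ y 0%N = Phi yin, gamlo <= gam 0%N <= gamhi &
   forall k, exists2 s, admissible_step (y k) (gam k) s &
     if eta <= rho (y k) s
     then y k.+1 = Phi (Rt (y k) s) /\ gamlo <= gam k.+1 <= gamhi
     else y k.+1 = y k /\ gam k.+1 = gamc * gam k].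

End TrustRegion.

(* Main.v *)
(* Accumulation points exist because the iterates lie in the image under [Phi]
   of the fiber over the bounded sublevel set, which is bounded for the
   Riemannian distance; completeness makes bounded sets relatively compact
   (Hopf-Rinow). The latter is proved for filters: if a filter in the ball
   [B(x, r)] has no cluster point, a cluster point [x'] of the midpoints between
   [x] and the filter is such that a finer filter in [B(x', 3r/4)] has no cluster
   point either; iterating gives a Cauchy sequence whose limit contradicts local
   compactness.

   Near a point that is not 2-critical, the model decreases by an amount which is
   bounded below in terms of the radius parameter, and it agrees with the pullback
   up to an arbitrarily small multiple of the squared step. Hence steps with a
   small enough parameter are accepted, and infinitely many visits near such a
   point would make [g] decrease without bound along the run. *)
Require Import Defs.
From mathcomp Require Import all_boot all_order all_algebra.
From mathcomp Require Import all_classical all_reals all_analysis.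
From mathcomp Require Import ring lra.
Import Defs.
Set Implicit Arguments.
Unset Strict Implicit.
Unset Printing Implicit Defensive.
Import Order.TTheory GRing.Theory Num.Theory.
Import numFieldNormedType.Exports.
Local Open Scope classical_set_scope.
Local Open Scope ring_scope.

(** * Functions of class [C^k] *)

(** The tangent space at [y] is read in [chart_at y], which may jump arbitrarily as [y] moves, so
    gradients, Hessians and norms at neighbouring points cannot be compared as row vectors. Local
    estimates therefore fix the chart at the point [z] of interest, transport vectors by [tvec], and
    compare [rnorm] with the sup norm of the components. Continuity of the gradient norm or of the
    least eigenvalue is never established: one-sided bounds, mostly obtained by testing on a fixed
    chart vector, are enough.

    The retraction is only known to first order, so the Hessian of the pullback depends on it; where
    the gradient vanishes it does not, and only there is it related to criticality.

    The order of the constants matters: first the acceptance threshold [gams] near [z], then the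
    least parameter [gamm] that a visit near [z] can have, then the decrease [kap]. A positive
    [gamm] exists because a rejection at the same iterate requires a parameter above [gams] and then
    shrinks it by the single factor [gamc]. *)

Section Ck.
Context {R : realType}.
Implicit Types V W : normedModType R.

Lemma near_translate V (a : V) (P : set V) :
  (\forall x \near a, P x) -> \forall h \near (0 : V), P (h + a).
Proof.
move=> Pa.
have : (h + a) @[h --> (0 : V)] --> a.
  rewrite -[X in _ --> X]add0r; apply: cvgD; [exact: cvg_id|exact: cvg_cst].
exact.
Qed.

Lemma near_eq_differentiable V W (f g : V -> W) (a : V) :
  (\near a, f a = g a) -> differentiable f a -> differentiable g a.
Proof.
move=> fg df.
have fga : f a = g a := nbhs_singleton fg.
have [dc] := (diff_locallyP a f).1 df.
move=> /eqaddoP dfo.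
have gE : (g \o shift a) = cst (g a) + 'd f a +o_ (0 : V) id.
  apply/eqaddoP => e e0.
  move: (near_translate fg) (dfo e e0); apply: filterS2 => h /= fgh.
  by rewrite !fctE /= -fga -fgh.
apply/diff_locallyP.
by rewrite (diff_unique dc gE); split.
Qed.

Lemma Ck_onS V W k (U U' : set V) (f : V -> W) :
  U' `<=` U -> Ck_on k U f -> Ck_on k U' f.
Proof.
elim: k f => [|k IH] f UU' /=; first by move=> cf x /UU'; exact: cf.
by case=> df Df; split=> [x /UU'|v]; [exact: df|exact: IH].
Qed.

Lemma Ck_on_eq V W k (U : set V) (f g : V -> W) : open U ->
  (forall x, U x -> f x = g x) -> Ck_on k U f -> Ck_on k U g.
Proof.
move=> oU; elim: k f g => [|k IH] f g fg /=.
  move=> cf x Ux; rewrite /prop_for /continuous_at -(fg _ Ux).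
  apply: cvg_trans (cf x Ux).
  apply: near_eq_cvg; near=> y; apply: fg; near: y.
  exact: open_nbhs_nbhs.
have nfg x : U x -> \near x, f x = g x.
  by move=> Ux; near=> y; apply: fg; near: y; exact: open_nbhs_nbhs.
case=> df Df; split=> [x Ux|v].
  exact: near_eq_differentiable (nfg x Ux) (df x Ux).
by apply: IH (Df v) => x Ux; exact: near_eq_derive (nfg x Ux).
Unshelve. all: by end_near. Qed.

Lemma Ck_onW V W k (U : set V) (f : V -> W) : Ck_on k.+1 U f -> Ck_on k U f.
Proof.
elim: k f => [|k IH] f.
  by case=> df _ x Ux; exact/differentiable_continuous/df.
by case=> df Df; split=> // v; exact/IH/Df.
Qed.

Lemma Ck_on_le V W j k (U : set V) (f : V -> W) : (j <= k)%N ->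
  Ck_on k U f -> Ck_on j U f.
Proof.
move=> /subnK <-; elim: (k - j)%N => // i IH; rewrite addSn => /Ck_onW; exact: IH.
Qed.

Lemma Ck_on_continuous V W k (U : set V) (f : V -> W) x : Ck_on k U f -> U x ->
  {for x, continuous f}.
Proof. by move=> /(Ck_on_le (leq0n k)); exact. Qed.

Lemma Ck_on_local V W k (U : set V) (f : V -> W) :
  (forall x, U x -> exists2 U', U' x & Ck_on k U' f) -> Ck_on k U f.
Proof.
elim: k f => [|k IH] f Uf /=; first by move=> x /Uf[U' U'x]; exact.
split=> [x /Uf[U' U'x [df _]]|v]; first exact: df.
by apply: IH => x /Uf[U' U'x [_ /(_ v)]]; exists U'.
Qed.

(** The difference quotients on both sides are literally equal, so the identity holds even where [f]
    has no derivative; [l] is the linear part of [a]. *)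
Lemma derive_comp_affine (V V' : normedModType R) W (f : V' -> W)
    (a : V -> V') (l : V -> V') x v :
  (forall x v (h : R), a (h *: v + x) = h *: l v + a x) ->
  'D_v (f \o a) x = 'D_(l v) f (a x).
Proof.
by move=> al; rewrite /derive /= /shift /=; under eq_fun do rewrite al.
Qed.

Lemma derive_affine V V' (a l : V -> V') x v :
  (forall x v (h : R), a (h *: v + x) = h *: l v + a x) -> 'D_v a x = l v.
Proof.
move=> al; rewrite -[RHS](@derive_id _ _ (a x)).
exact: (@derive_comp_affine _ _ _ id).
Qed.

Lemma Ck_on_affine (V V' : normedModType R) W k (U : set V') (f : V' -> W)
    (a : V -> V') (l : V -> V') :
  (forall x v (h : R), a (h *: v + x) = h *: l v + a x) ->
  (forall x, differentiable a x) ->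
  Ck_on k U f -> Ck_on k (a @^-1` U) (f \o a).
Proof.
move=> al da; elim: k f => [|k IH] f /=.
  move=> cf x Ux; apply: continuous_comp; last exact: cf.
  exact: differentiable_continuous.
case=> df Df; split=> [x Ux|v].
  by apply: differentiable_comp => //; exact: df.
suff -> : 'D_v (f \o a) = 'D_(l v) f \o a by exact: IH.
by apply/funext => x; exact: derive_comp_affine.
Qed.

Lemma Ck_on_cst V W k (U : set V) (a : W) : Ck_on k U (cst a : V -> W).
Proof.
elim: k a => [|k IH] a /=; first by move=> x _; exact: cvg_cst.
split=> [x _|v]; first exact: differentiable_cst.
suff -> : 'D_v (cst a : V -> W) = cst 0 by [].
by apply/funext => x; exact: derive_cst.
Qed.

Lemma Ck_onD V W k (U : set V) (f g : V -> W) : open U ->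
  Ck_on k U f -> Ck_on k U g -> Ck_on k U (f \+ g).
Proof.
move=> oU; elim: k f g => [|k IH] f g /=.
  by move=> cf cg x Ux; apply: cvgD; [exact: cf|exact: cg].
case=> df Df [dg Dg]; split=> [x Ux|v].
  by apply: differentiableD; [exact: df|exact: dg].
apply: (Ck_on_eq oU) (IH _ _ (Df v) (Dg v)) => x Ux /=.
by rewrite -deriveD //; apply: diff_derivable; [exact: df|exact: dg].
Qed.

Lemma Ck_onM V k (U : set V) (f g : V -> R^o) : open U ->
  Ck_on k U f -> Ck_on k U g -> Ck_on k U (fun x => f x * g x : R^o).
Proof.
move=> oU; elim: k f g => [|k IH] f g.
  by move=> cf cg x Ux; apply: (cvgM (cf x Ux) (cg x Ux)).
move=> Cf Cg; have [df Df] := Cf; have [dg Dg] := Cg; split=> [x Ux|v].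
  by apply: differentiableM; [exact: df|exact: dg].
have CfDg := IH _ _ (Ck_onW Cf) (Dg v).
have CgDf := IH _ _ (Ck_onW Cg) (Df v).
apply: (Ck_on_eq oU) (Ck_onD oU CfDg CgDf) => x Ux /=.
rewrite (_ : (fun _ => _) = (f : V -> R) * (g : V -> R)) //.
by rewrite deriveM //; apply: diff_derivable; [exact: df|exact: dg].
Qed.

Lemma Ck_on_sum V W k (U : set V) n (f : 'I_n -> V -> W) : open U ->
  (forall i, Ck_on k U (f i)) -> Ck_on k U (fun x => \sum_i f i x).
Proof.
move=> oU; elim: n f => [|n IH] f Cf.
  by under [X in Ck_on _ _ X]eq_fun do rewrite big_ord0; exact: Ck_on_cst.
under [X in Ck_on _ _ X]eq_fun do rewrite big_ord_recl.
by apply: Ck_onD => //; exact: IH.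
Qed.

Lemma derive_coord V m (h : V -> 'rV[R]_m) x v i : differentiable h x ->
  'D_v (fun x => h x 0 i : R^o) x = 'D_v h x 0 i.
Proof.
by move=> dh; rewrite derive_mx ?mxE //; exact: diff_derivable.
Qed.

Lemma Ck_on_coord V m k (U : set V) (h : V -> 'rV[R]_m) i : open U ->
  Ck_on k U h -> Ck_on k U (fun x => h x 0 i : R^o).
Proof.
move=> oU; elim: k h => [|k IH] h /=.
  move=> ch x Ux; exact: (@continuous_comp _ _ _ h (fun M : 'rV_m => M 0 i : R^o) x
    (ch x Ux) (@coord_continuous R 1 m 0 i (h x))).
case=> dh Dh; split=> [x Ux|v].
  exact: (@differentiable_comp _ _ _ _ h (fun M : 'rV_m => M 0 i : R^o) x
    (dh x Ux) (differentiable_coord _ _ _)).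
apply: (Ck_on_eq oU) (IH _ (Dh v)) => x Ux /=; rewrite derive_coord //.
exact: dh.
Qed.

Lemma diff_sum_basis m W (f : 'rV[R]_m -> W) x v : differentiable f x ->
  'D_v f x = \sum_i v 0 i *: 'D_('e_i) f x.
Proof.
move=> df; rewrite deriveE // {1}(row_sum_delta v) linear_sum.
by apply: eq_bigr => i _; rewrite linearZ deriveE.
Qed.

Lemma derive_comp_basis V m W (f : 'rV[R]_m -> W) (h : V -> 'rV[R]_m) x v :
  differentiable h x -> differentiable f (h x) ->
  'D_v (f \o h) x = 'D_('D_v h x) f (h x).
Proof.
move=> dh df; rewrite deriveE; last exact: differentiable_comp.
by rewrite diff_comp //= -deriveE // -deriveE.
Qed.

(** The chain rule yields a derivative of [f] in the moving direction ['D_v h x], while [Ck_on]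
    speaks of fixed directions only. Expanding on the basis ['e_i] gives a sum of products to which
    the induction hypothesis applies. *)
Lemma Ck_on_comp V m k (U : set V) (U' : set 'rV[R]_m) (f : 'rV[R]_m -> R^o)
    (h : V -> 'rV[R]_m) : open U -> open U' -> U `<=` h @^-1` U' ->
  Ck_on k U h -> Ck_on k U' f -> Ck_on k U (f \o h).
Proof.
move=> oU oU' UU'; elim: k f => [|k IH] f Ch.
  move=> cf x Ux; apply: (continuous_comp (Ch x Ux)).
  by apply: cf; exact: UU'.
move=> Cf; have [df Df] := Cf; have [dh Dh] := Ch; split=> [x Ux|v].
  by apply: differentiable_comp; [exact: dh|apply: df; exact: UU'].
pose F x := \sum_i ('D_v h x 0 i * ('D_('e_i) f \o h) x) : R^o.
apply: (@Ck_on_eq _ _ _ _ F) => // [x Ux|].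
  have dfx : differentiable f (h x) by apply: df; exact: UU'.
  by rewrite derive_comp_basis ?diff_sum_basis //; exact: dh.
apply: Ck_on_sum => // i; apply: Ck_onM => //.
  exact: Ck_on_coord (Dh v).
exact: IH (Ck_onW Ch) (Df _).
Qed.

End Ck.

(** * Symmetric bilinear forms *)

Lemma for_continuous_sum (R : realType) (T : topologicalType)
    (V : normedModType R) m (F : 'I_m -> T -> V) (x : T) :
  (forall i, {for x, continuous (F i)}) ->
  {for x, continuous (fun x => \sum_i F i x)}.
Proof.
move=> cF; apply: (@cvg_big V 'I_m +%R 0 predT _ T (nbhs x)) => [|i _].
  exact: add_continuous.
exact: cF.
Qed.

Section BilinearForm.
Context {R : realType} {n : nat}.
Implicit Types (B : 'rV[R]_n -> 'rV[R]_n -> R) (u v w : 'rV[R]_n).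

Definition sym_bilinear B :=
  (forall u v, B u v = B v u) /\
  (forall a u v w, B (a *: u + v) w = a * B u w + B v w).

Definition posdef B := forall u, u != 0 -> 0 < B u u.

Lemma mx_coord_le v i : `|v 0 i| <= `|v|.
Proof.
rewrite [leRHS]/Num.Def.normr/= mx_normrE.
exact: (le_bigmax _ (fun i => `|v i.1 i.2|) (0, i)).
Qed.

Section Theory.
Context {B} (Bsb : sym_bilinear B).

Lemma sbfC u v : B u v = B v u. Proof. by case: Bsb. Qed.

Lemma sbfDl u v w : B (u + v) w = B u w + B v w.
Proof. by case: Bsb => _ /(_ 1 u v w); rewrite scale1r mul1r. Qed.

Lemma sbf0l w : B 0 w = 0.
Proof. by apply: (@addrI _ (B 0 w)); rewrite -sbfDl !addr0. Qed.

Lemma sbfZl a u w : B (a *: u) w = a * B u w.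
Proof. by case: Bsb => _ /(_ a u 0 w); rewrite sbf0l !addr0. Qed.

Lemma sbfNl u w : B (- u) w = - B u w.
Proof. by rewrite -scaleN1r sbfZl mulN1r. Qed.

Lemma sbfDr u v w : B u (v + w) = B u v + B u w.
Proof. by rewrite sbfC sbfDl !(sbfC _ u). Qed.

Lemma sbfZr a u w : B u (a *: w) = a * B u w.
Proof. by rewrite sbfC sbfZl sbfC. Qed.

Lemma sbfNr u w : B u (- w) = - B u w.
Proof. by rewrite sbfC sbfNl sbfC. Qed.

Lemma sbf_suml I (r : seq I) (F : I -> 'rV_n) w :
  B (\sum_(i <- r) F i) w = \sum_(i <- r) B (F i) w.
Proof.
by elim/big_rec2: _ => [|i x y _ <-]; rewrite ?sbf0l // sbfDl.
Qed.

Lemma form_expand u v :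
  B u v = \sum_i \sum_j u 0 i * v 0 j * B 'e_i 'e_j.
Proof.
rewrite {1}(row_sum_delta u) sbf_suml; apply: eq_bigr => i _.
rewrite sbfZl sbfC {1}(row_sum_delta v) sbf_suml mulr_sumr.
by apply: eq_bigr => j _; rewrite sbfZl mulrA (sbfC 'e_j).
Qed.

(** Stated for semidefinite forms, because the eigenvector argument below applies it to a degenerate
    one. *)
Lemma form_CS (Bge0 : forall u, 0 <= B u u) u v :
  B u v ^+ 2 <= B u u * B v v.
Proof.
have key a b : 0 <= a ^+ 2 * B u u + 2 * a * b * B u v + b ^+ 2 * B v v.
  rewrite [leRHS](_ : _ = B (a *: u + b *: v) (a *: u + b *: v)) //.
  by rewrite !(sbfDl, sbfDr, sbfZl, sbfZr) (sbfC v u); ring.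
have := Bge0 v; rewrite le_eqVlt => /orP[/eqP v0|v0].
  rewrite -v0 mulr0 exprn_even_le0 //=; apply/eqP/eqP; rewrite -[_ == _]negbK.
  (* With [B v v = 0] the quadratic in [key] is affine in [b], and these coefficients give it the
     value -1. *)
  apply/negP => Buv0; have := key 1 (- (B u u + 1) / (2 * B u v)).
  rewrite -v0 leNgt => /negP; apply.
  have -> : 1 ^+ 2 * B u u + 2 * 1 * (- (B u u + 1) / (2 * B u v)) * B u v +
    (- (B u u + 1) / (2 * B u v)) ^+ 2 * 0 = -1 by field.
  by rewrite ltrN10.
have := key (B v v) (- B u v).
have -> : B v v ^+ 2 * B u u + 2 * B v v * - B u v * B u v +
  (- B u v) ^+ 2 * B v v = B v v * (B u u * B v v - B u v ^+ 2) by ring.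
by rewrite pmulr_rge0 // subr_ge0.
Qed.

End Theory.

Definition fnorm B u : R := Num.sqrt (B u u).

Section PosDef.
Context {B} (Bsb : sym_bilinear B) (Bpos : posdef B).

Lemma form_ge0 u : 0 <= B u u.
Proof.
by have [->|/Bpos/ltW//] := eqVneq u 0; rewrite (sbf0l Bsb).
Qed.

Lemma fnorm_ge0 u : 0 <= fnorm B u. Proof. exact: sqrtr_ge0. Qed.

Lemma fnorm_sqr u : fnorm B u ^+ 2 = B u u.
Proof. by rewrite sqr_sqrtr // form_ge0. Qed.

Lemma fnormZ a u : fnorm B (a *: u) = `|a| * fnorm B u.
Proof.
rewrite /fnorm (sbfZl Bsb) (sbfZr Bsb) mulrA -expr2 sqrtrM ?sqr_ge0 //.
by rewrite sqrtr_sqr.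
Qed.

Lemma fnormN u : fnorm B (- u) = fnorm B u.
Proof. by rewrite -scaleN1r fnormZ normrN1 mul1r. Qed.

Lemma fnorm0 : fnorm B 0 = 0.
Proof. by rewrite /fnorm (sbf0l Bsb) sqrtr0. Qed.

Lemma fnorm_eq0 u : (fnorm B u == 0) = (u == 0).
Proof.
apply/idP/eqP => [|->]; last by rewrite fnorm0.
move=> /eqP u0; apply/eqP/negPn/negP => /Bpos.
by rewrite -fnorm_sqr u0 expr0n ltxx.
Qed.

Lemma fnorm_CS u v : `|B u v| <= fnorm B u * fnorm B v.
Proof.
rewrite -(@ler_pXn2r _ 2) ?nnegrE ?mulr_ge0 ?fnorm_ge0 ?normr_ge0 //.
by rewrite exprMn !fnorm_sqr real_normK ?num_real // form_CS //; exact: form_ge0.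
Qed.

Lemma form_inj u v : (forall w, B u w = B v w) -> u = v.
Proof.
move=> uv; apply/eqP; rewrite -subr_eq0; apply/negPn/negP => /Bpos.
by rewrite {1}/GRing.add /= (sbfDl Bsb) (sbfNl Bsb) uv subrr ltxx.
Qed.

(** Positive definiteness makes the Gram matrix [A] injective, hence invertible. This existence is
    what keeps the [xget] in [gradient] and [hessian] from returning its default. *)
Lemma form_riesz (L : 'rV[R]_n -> R) :
  (forall a u v, L (a *: u + v) = a * L u + L v) ->
  exists v, forall w, B v w = L w.
Proof.
move=> Llin; pose A := \matrix_(i < n, j < n) B 'e_i 'e_j.
have AE u j : (u *m A) 0 j = B u 'e_j.
  rewrite mxE {2}(row_sum_delta u) (sbf_suml Bsb); apply: eq_bigr => i _.
  by rewrite (sbfZl Bsb) mxE.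
have Au : A \in unitmx.
  rewrite -row_free_unit; apply: inj_row_free => u uA0.
  apply: form_inj => w; rewrite (sbf0l Bsb) (sbfC Bsb) {1}(row_sum_delta w).
  rewrite (sbf_suml Bsb) big1 // => j _.
  by rewrite (sbfZl Bsb) (sbfC Bsb) -AE uA0 mxE mulr0.
have L0 : L 0 = 0.
  by have := Llin (-1) 0 0; rewrite scaler0 addr0 mulN1r addNr.
have Lsum w : L w = \sum_j w 0 j * L 'e_j.
  rewrite {1}(row_sum_delta w); elim/big_rec2: _ => // i x y _ <-.
  by rewrite Llin.
exists ((\row_j L 'e_j) *m invmx A) => w; rewrite Lsum.
rewrite (sbfC Bsb) {1}(row_sum_delta w) (sbf_suml Bsb); apply: eq_bigr => j _.
by rewrite (sbfZl Bsb) (sbfC Bsb) -AE mulmxKV // mxE.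
Qed.

End PosDef.

(** The point [x] will be a chart point, a curve parameter or a pair (base point, vector);
    regularity in it reduces to that of finitely many scalar functions. *)
Definition mx_form {T : Type} (a : 'I_n -> 'I_n -> T -> R) (x : T) u v : R :=
  \sum_i \sum_j u 0 i * v 0 j * a i j x.

Lemma continuous_form (T : topologicalType) (a : 'I_n -> 'I_n -> T -> R)
    (u v : T -> 'rV[R]_n) (x : T) :
  (forall i j, {for x, continuous (a i j)}) ->
  {for x, continuous u} -> {for x, continuous v} ->
  {for x, continuous (fun x => mx_form a x (u x) (v x))}.
Proof.
move=> ca cu cv; rewrite /mx_form.
have coordc (w : T -> 'rV[R]_n) i : {for x, continuous w} ->
    {for x, continuous (fun x => w x 0 i)}.
  move=> cw; exact: (@continuous_comp _ _ _ w (fun M : 'rV_n => M 0 i) x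
    cw (@coord_continuous R 1 n 0 i (w x))).
apply: for_continuous_sum => i; apply: for_continuous_sum => j.
by apply: cvgM; [apply: cvgM; exact: coordc|exact: ca].
Qed.

Lemma mx_form_le T (a : 'I_n -> 'I_n -> T -> R) x (b : R) v :
  (forall i j, `|a i j x| <= b) ->
  `|mx_form a x v v| <= n%:R * n%:R * b * `|v| ^+ 2.
Proof.
move=> ab; apply: (le_trans (ler_norm_sum _ _ _)).
apply: (@le_trans _ _ (\sum_(i < n) n%:R * b * `|v| ^+ 2)); last first.
  by rewrite sumr_const card_ord -[leLHS]mulr_natl -!mulrA.
apply: ler_sum => i _; apply: (le_trans (ler_norm_sum _ _ _)).
apply: (@le_trans _ _ (\sum_(j < n) b * `|v| ^+ 2)); last first.
  by rewrite sumr_const card_ord -[leLHS]mulr_natl -!mulrA.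
apply: ler_sum => j _; rewrite normrM mulrC; apply: ler_pM => //.
by rewrite normrM expr2; apply: ler_pM => //; exact: mx_coord_le.
Qed.

Lemma near_form_upper (T : topologicalType) (a : 'I_n -> 'I_n -> T -> R) x0 :
  (forall i j, {for x0, continuous (a i j)}) ->
  exists2 b, 0 < b & \forall x \near x0, forall v,
    `|mx_form a x v v| <= b * `|v| ^+ 2.
Proof.
move=> ca; pose b0 := \sum_i \sum_j `|a i j x0| + 1.
have b0ge0 : 0 <= \sum_i \sum_j `|a i j x0|.
  by apply: sumr_ge0 => i _; apply: sumr_ge0.
exists (n%:R * n%:R * b0 + 1).
  by rewrite ltr_wpDl // !mulr_ge0 // addr_ge0.
have H : \forall x \near x0, forall i j, `|a i j x| <= b0.
  apply: filter_forall => i; apply: filter_forall => j.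
  have /cvgrPdist_le/(_ 1 ltr01) := ca i j.
  apply: filterS => x xx0; rewrite /b0.
  have : `|a i j x0| <= \sum_i \sum_j `|a i j x0|.
    rewrite (bigD1 i) //= (bigD1 j) //= -addrA lerDl addr_ge0 //.
      by apply: sumr_ge0.
    by apply: sumr_ge0 => ? _; apply: sumr_ge0.
  move=> h; have := ler_normB (a i j x0) (a i j x0 - a i j x).
  by rewrite subKr; lra.
apply: filterS H => x ab v.
apply: le_trans (mx_form_le v ab) _.
by rewrite ler_wpM2r ?sqr_ge0 // lerDl.
Qed.

(** Continuity is asked away from 0 only, since one use is a Rayleigh quotient; the nonzero [u]
    rules out dimension 0, where the sphere is empty. *)
Lemma sphere_min (q : 'rV[R]_n -> R) (u : 'rV[R]_n) : u != 0 ->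
  (forall v, v != 0 -> {for v, continuous q}) ->
  exists2 e, `|e| = 1 & forall v, `|v| = 1 -> q e <= q v.
Proof.
move=> u0 cq; pose S := [set v : 'rV[R]_n | `|v| = 1].
have S0 : S !=set0.
  exists (`|u|^-1 *: u); rewrite /S /= normrZ normfV normr_id mulVf //.
  by rewrite normr_eq0.
have cS : compact S.
  apply: bounded_closed_compact.
    by exists 1; split=> // y y1 v /= ->; exact: ltW.
  apply: (@closed_comp _ _ (fun v : 'rV[R]_n => `|v|) [set 1]).
    by move=> v _; exact: norm_continuous.
  exact: closed_eq.
have [|e] := EVT_min_rV S0 cS (f := q).
  apply: continuous_in_subspaceT => v; rewrite inE => v1; apply: cq.
  by rewrite -normr_eq0 v1 oner_eq0.
rewrite inE => eS emin; exists e => // v vS; apply: emin.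
by rewrite inE.
Qed.

(** Compactness of the unit sphere gives a positive constant at [x0], and half of it survives a
    small perturbation of the coefficients. *)
Lemma near_form_lower (T : topologicalType) (a : 'I_n -> 'I_n -> T -> R) x0 :
  (forall i j, {for x0, continuous (a i j)}) -> posdef (mx_form a x0) ->
  exists2 b, 0 < b & \forall x \near x0, forall v,
    b * `|v| ^+ 2 <= mx_form a x v v.
Proof.
move=> ca pa.
have [b b0 lb] : exists2 b, 0 < b & forall v, b * `|v| ^+ 2 <= mx_form a x0 v v.
  have form0 : mx_form a x0 0 0 = 0.
    rewrite /mx_form big1 // => i _; rewrite big1 // => j _.
    by rewrite !mxE !mul0r.
  have [[u u0]|/forallNP noU] := pselect (exists u : 'rV[R]_n, u != 0); last first.
    exists 1 => // v; have /negP/negPn/eqP -> := noU v.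
    by rewrite normr0 expr0n mulr0 form0.
  have cq : continuous (fun v : 'rV[R]_n => mx_form a x0 v v).
    move=> v; apply: (@continuous_form _ (fun i j _ => a i j x0) id id).
    - by move=> i j; exact: cst_continuous.
    - exact: cvg_id.
    - exact: cvg_id.
  have [e e1 emin] := sphere_min u0 (fun v _ => cq v).
  have e0 : e != 0 by rewrite -normr_eq0 e1 oner_eq0.
  exists (mx_form a x0 e e); first exact: pa.
  move=> v; have [->|v0] := eqVneq v 0.
    by rewrite normr0 expr0n mulr0 form0.
  have nv0 : `|v| != 0 by rewrite normr_eq0.
  have /emin : `| `|v|^-1 *: v| = 1 by rewrite normrZ normfV normr_id mulVf.
  set q' := mx_form _ _ (_ *: _) _.
  have -> : q' = `|v| ^- 2 * mx_form a x0 v v.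
    rewrite /q' /mx_form mulr_sumr; apply: eq_bigr => i _; rewrite mulr_sumr.
    by apply: eq_bigr => j _; rewrite !mxE; field.
  by rewrite ler_pdivlMl ?exprn_gt0 ?normr_gt0 // mulrC.
exists (b / 2); first by rewrite divr_gt0.
(* The form moves by at most [n ^ 2 * eps * |v| ^ 2], so the loss stays below [b / 2]; the [+ 1]
   covers [n = 0]. *)
pose eps := b / (2 * (n%:R * n%:R + 1)).
have nn0 : 0 < (n%:R * n%:R + 1 : R) by rewrite ltr_wpDl // mulr_ge0.
have eps0 : 0 < eps by rewrite divr_gt0 // mulr_gt0.
have H : \forall x \near x0, forall i j, `|a i j x - a i j x0| <= eps.
  apply: filter_forall => i; apply: filter_forall => j.
  have /cvgrPdist_le/(_ _ eps0) := ca i j.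
  by apply: filterS => x; rewrite distrC.
apply: filterS H => x ax v.
have := @mx_form_le T (fun i j x => a i j x - a i j x0) x eps v ax.
rewrite {1}/mx_form.
under eq_bigr do under eq_bigr do rewrite mulrBr.
under eq_bigr do rewrite sumrB.
rewrite sumrB -/(mx_form a x v v) -/(mx_form a x0 v v) => /ler_normlP[le1 _].
have := lb v.
have : n%:R * n%:R * eps * `|v| ^+ 2 <= b / 2 * `|v| ^+ 2.
  rewrite ler_wpM2r ?sqr_ge0 // /eps.
  rewrite [leRHS](_ : _ = (n%:R * n%:R + 1) * (b / (2 * (n%:R * n%:R + 1)))).
    by rewrite ler_wpM2r ?(ltW eps0) // lerDl.
  by field; rewrite gt_eqF.
lra.
Qed.

End BilinearForm.

(** * Least eigenvalue and Rayleigh quotient *)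

Section Rayleigh.
Context {R : realType} {n : nat} (ip : 'rV[R]_n -> 'rV[R]_n -> R).
Context (ipsb : sym_bilinear ip) (ippos : posdef ip).

(** The Rayleigh quotient is homogeneous of degree 0, so a minimizer [e] on the sup-norm sphere is a
    global one. Then [P] is semidefinite with [P e e = 0], Cauchy-Schwarz gives [P e w = 0] for all
    [w], and [e] is an eigenvector for [mu]. Thus [least_eigenval] is a genuine eigenvalue and not
    the default of [xget]. *)
Lemma least_eigenval_le (H : 'rV[R]_n -> 'rV[R]_n) s :
  sym_bilinear (fun u v => ip (H u) v) -> s != 0 ->
  least_eigenval H * ip s s <= ip (H s) s.
Proof.
move=> Hsb s0.
have cq B : sym_bilinear B -> continuous (fun v : 'rV[R]_n => B v v).
  move=> Bsb v.
  rewrite (_ : (fun v => B v v) =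
    (fun v => mx_form (fun i j (_ : 'rV[R]_n) => B 'e_i 'e_j) v v v)).
    by apply: continuous_form => [i j||];
      [exact: cst_continuous|exact: cvg_id|exact: cvg_id].
  by apply/funext => w; rewrite (form_expand Bsb).
have [|e e1 emin] := @sphere_min _ _ (fun v => ip (H v) v / ip v v) s s0.
  move=> v v0; have cH := cq _ Hsb v; have ci := cq _ ipsb v.
  apply: (@cvgM _ _ _ _ (fun v => ip (H v) v) (fun v => (ip v v)^-1) _ _ cH).
  by apply: cvgV ci; rewrite gt_eqF // ippos.
have e0 : e != 0 by rewrite -normr_eq0 e1 oner_eq0.
have ipe := ippos e0.
pose mu := ip (H e) e / ip e e; pose P u v := ip (H u) v - mu * ip u v.
have HZl a u w : ip (H (a *: u)) w = a * ip (H u) w := sbfZl Hsb a u w.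
have HD a u v w : ip (H (a *: u + v)) w = a * ip (H u) w + ip (H v) w :=
  Hsb.2 a u v w.
have Psb : sym_bilinear P.
  split=> [u v|a u v w]; rewrite /P; first by rewrite (ipsb.1 u) (Hsb.1 u).
  by rewrite HD (ipsb.2 a); ring.
have Pe : P e e = 0 by rewrite /P /mu divfK ?subrr // gt_eqF.
have Pge0 v : 0 <= P v v.
  have [->|v0] := eqVneq v 0; first by rewrite (sbf0l Psb).
  have nv0 : `|v| != 0 by rewrite normr_eq0.
  have := emin (`|v|^-1 *: v).
  rewrite normrZ normfV normr_id mulVf // => /(_ erefl).
  rewrite (sbfZl ipsb) (sbfZr ipsb) HZl (sbfZr ipsb).
  rewrite -mulf_div divff ?invr_eq0 // mul1r -mulf_div divff ?invr_eq0 // mul1r.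
  by rewrite -/mu ler_pdivlMr ?ippos // /P subr_ge0.
have He : H e = mu *: e.
  apply: (form_inj ipsb ippos) => w; rewrite (sbfZl ipsb).
  apply/eqP; rewrite -subr_eq0 -/(P e w) -sqrf_eq0 eq_le sqr_ge0 andbT.
  by have := form_CS Psb Pge0 e w; rewrite Pe mul0r.
have muP : eigenval H mu /\ forall l', eigenval H l' -> mu <= l'.
  split=> [|l' [v v0 Hv]]; first by exists e.
  have := Pge0 v; rewrite /P Hv (sbfZl ipsb) -mulrBl pmulr_lge0 ?ippos //.
  by rewrite subr_ge0.
have -> : least_eigenval H = mu.
  apply: xget_unique => // l [l1 l2]; apply/eqP.
  by rewrite eq_le muP.2 // l2 //; case: muP.
by have := Pge0 s; rewrite /P subr_ge0.
Qed.

End Rayleigh.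

(** * Charts and tangent vectors *)

Lemma near_preim (S T : topologicalType) (h : S -> T) (x : S) (P : set T) :
  {for x, continuous h} -> (\forall y \near h x, P y) ->
  \forall z \near x, P (h z).
Proof. by move=> ch; exact: ch. Qed.

Section Charts.
Context {R : realType} {n : nat} {M : topologicalType}.
Implicit Types c d : chart R n M.

Lemma cinv_img c x : img c x -> dom c (cinv c x) /\ coord c (cinv c x) = x.
Proof. by case=> y cy <-; rewrite coordK. Qed.

Lemma img_coord c y : dom c y -> img c (coord c y).
Proof. by move=> cy; exists y. Qed.

Lemma near_dom c y : dom c y -> \forall z \near y, dom c z.
Proof. by move=> cy; apply: open_nbhs_nbhs; split=> //; exact: dom_open. Qed.

Lemma near_img c x : img c x -> \forall z \near x, img c z.
Proof. by move=> cx; apply: open_nbhs_nbhs; split=> //; exact: img_open. Qed.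

Lemma near_coord c y (P : set 'rV[R]_n) : dom c y ->
  (\forall x \near coord c y, P x) -> \forall z \near y, P (coord c z).
Proof. by move=> cy; have := @coord_cont _ _ _ c y cy; exact. Qed.

Lemma overlapE c (D : set M) :
  coord c @` (dom c `&` D) = img c `&` cinv c @^-1` D.
Proof.
apply/seteqP; split=> [x [y [cy Dy] <-]|x [cx Dx]].
  by split; [exists y|rewrite /= coordK].
by have [] := cinv_img cx; exists (cinv c x).
Qed.

End Charts.

Section Manifold.
Context {R : realType} {n : nat} {M : manifold R n}.
Implicit Types (c d e : chart R n M) (y : M) (v w : 'rV[R]_n).

Hint Resolve chart_at_atlas chart_at_dom : core.

(** [tvec] with an arbitrary target chart. Two free charts give a cocycle ([dtrans_comp]), from
    which the inverse of [tvec c y] is obtained. *)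
Definition dtrans c d y v : 'rV[R]_n := 'D_v (coord d \o cinv c) (coord c y).

Lemma transition_Ck k c d : atlas M c -> atlas M d ->
  Ck_on k (coord c @` (dom c `&` dom d)) (coord d \o cinv c).
Proof. by move=> ac ad; exact: transition_smooth. Qed.

Lemma transition_diff c d y : atlas M c -> atlas M d -> dom c y -> dom d y ->
  differentiable (coord d \o cinv c) (coord c y).
Proof.
move=> ac ad cy dy; have [+ _] := transition_Ck 1 ac ad.
by apply; exists y.
Qed.

Lemma dtrans_linear c d y a v w :
  atlas M c -> atlas M d -> dom c y -> dom d y ->
  dtrans c d y (a *: v + w) = a *: dtrans c d y v + dtrans c d y w.
Proof.
move=> ac ad cy dy; have df := transition_diff ac ad cy dy.
by rewrite /dtrans !deriveE // linearP.
Qed.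

Lemma dtransxx c y v : atlas M c -> dom c y -> dtrans c c y v = v.
Proof.
move=> ac cy; rewrite /dtrans -[RHS](@derive_id _ _ (coord c y)).
apply: near_eq_derive; apply: filterS (near_img (img_coord cy)) => x cx /=.
by have [] := cinv_img cx.
Qed.

Lemma derive_chart_change (V : normedModType R) (h : V -> M) c d x (v : V) :
  atlas M c -> atlas M d -> dom c (h x) -> dom d (h x) ->
  {for x, continuous h} -> differentiable (coord c \o h) x ->
  'D_v (coord d \o h) x = dtrans c d (h x) ('D_v (coord c \o h) x).
Proof.
move=> ac ad cx dx ch dh.
rewrite /dtrans -derive_comp_basis //; last exact: transition_diff.
apply: near_eq_derive.
by apply: filterS (near_preim ch (near_dom cx)) => y cy /=; rewrite coordK.
Qed.

Lemma dtrans_comp c d e y v : atlas M c -> atlas M d -> atlas M e ->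
  dom c y -> dom d y -> dom e y ->
  dtrans d e y (dtrans c d y v) = dtrans c e y v.
Proof.
move=> ac ad ae cy dy ey; apply/esym.
have := @derive_chart_change _ (cinv c) d e (coord c y) v ad ae.
rewrite coordK //; apply => //; last exact: transition_diff.
by apply: cinv_cont; exact: img_coord.
Qed.

Lemma tvec_dtrans c y v : tvec c y v = dtrans c (chart_at y) y v.
Proof. by []. Qed.

Lemma tvec_chart_at y v : tvec (chart_at y) y v = v.
Proof. by rewrite tvec_dtrans dtransxx. Qed.

Lemma tvec_linear c y a v w : atlas M c -> dom c y ->
  tvec c y (a *: v + w) = a *: tvec c y v + tvec c y w.
Proof. by move=> ac cy; rewrite !tvec_dtrans dtrans_linear. Qed.

Lemma tvec0 c y : atlas M c -> dom c y -> tvec c y 0 = 0.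
Proof.
move=> ac cy; have := tvec_linear (-1) 0 0 ac cy.
by rewrite scaler0 addr0 scaleN1r addNr.
Qed.

Lemma tvec_surj c y w : atlas M c -> dom c y -> exists v, tvec c y v = w.
Proof.
move=> ac cy; exists (dtrans (chart_at y) c y w).
by rewrite tvec_dtrans dtrans_comp // dtransxx.
Qed.

Lemma tvec_inj0 c y v : atlas M c -> dom c y -> tvec c y v = 0 -> v = 0.
Proof.
move=> ac cy v0; rewrite -[LHS](dtransxx v ac cy).
rewrite -(@dtrans_comp c (chart_at y) c) // -tvec_dtrans v0.
have := @dtrans_linear (chart_at y) c y (-1) 0 0.
by rewrite scaler0 addr0 scaleN1r addNr => ->.
Qed.

End Manifold.

Section Metric.
Context {R : realType} {n : nat} {M : manifold R n} (G : riemannian_metric M).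
Implicit Types (c d : chart R n M) (y : M) (u v w : 'rV[R]_n).

Lemma inner_sb y : sym_bilinear (G y).
Proof. by split=> *; [exact: inner_sym|exact: inner_linear]. Qed.

Lemma inner_pd y : posdef (G y).
Proof. by move=> u; exact: inner_pos. Qed.

Definition gram c (i j : 'I_n) (x : 'rV[R]_n) : R :=
  G (cinv c x) (tvec c (cinv c x) 'e_i) (tvec c (cinv c x) 'e_j).

Lemma tvec_sb c y : atlas M c -> dom c y ->
  sym_bilinear (fun v w => G y (tvec c y v) (tvec c y w)).
Proof.
move=> ac cy; split=> [u v|a u v w]; first exact: inner_sym.
by rewrite tvec_linear // inner_linear.
Qed.

Lemma gramE c x v w : atlas M c -> img c x ->
  G (cinv c x) (tvec c (cinv c x) v) (tvec c (cinv c x) w) =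
  mx_form (gram c) x v w.
Proof.
by move=> ac /cinv_img[cy _]; exact: (form_expand (tvec_sb ac cy)).
Qed.

Lemma gram_continuous c i j x : atlas M c -> img c x ->
  {for x, continuous (gram c i j)}.
Proof.
move=> ac cx; exact: (@inner_smooth _ _ _ G c ac 'e_i 'e_j 0%N x cx).
Qed.

Lemma gram_pd c x : atlas M c -> img c x -> posdef (mx_form (gram c) x).
Proof.
move=> ac cx u u0; rewrite -gramE //; apply: inner_pos.
have [cy _] := cinv_img cx.
by apply: contra_neq u0 => /(tvec_inj0 ac cy).
Qed.

(** The Gram matrix is continuous and positive definite, so bounds on its quadratic form persist
    near [x]. This turns sup-norm estimates in a chart into Riemannian ones with constants
    independent of the point. *)
Lemma metric_comparable c x : atlas M c -> img c x ->
  exists a b, [/\ 0 < a, 0 < b & \forall z \near x, img c z /\ forall v,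
    a * `|v| <= rnorm G (cinv c z) (tvec c (cinv c z) v) <= b * `|v|].
Proof.
move=> ac cx.
have cg i j := @gram_continuous c i j x ac cx.
have [a a0 la] := near_form_lower cg (gram_pd ac cx).
have [b b0 ub] := near_form_upper cg.
exists (Num.sqrt a), (Num.sqrt b); rewrite !sqrtr_gt0; split=> //.
apply: filterS3 (near_img cx) la ub => z cz az bz; split=> // v.
rewrite /rnorm gramE // -[`|v|]ger0_norm // -sqrtr_sqr -!sqrtrM ?(ltW a0) ?(ltW b0) //.
rewrite !ler_wsqrtr ?az //; apply: le_trans (bz v); exact: ler_norm.
Qed.

End Metric.

Arguments inner_pd {R n M} G y u _.

(** * The Hopf-Rinow theorem *)

Section HopfRinow.
(** [D r x y] stands for a distance from [x] to [y] less than [r]; a relation avoids arithmetic on a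
    distance that may be infinite. [D_mid] is the length-space property, which supplies intermediate
    points without any shortest curve. *)
Context {R : realType} {T : topologicalType} (D : R -> T -> T -> Prop).
Context (D_le : forall r s x y, r <= s -> D r x y -> D s x y)
  (D_sym : forall r x y, D r x y -> D r y x)
  (D_trans : forall r s x y z, D r x y -> D s y z -> D (r + s) x z)
  (D_mid : forall r s x z, 0 < r -> 0 < s -> D (r + s) x z ->
    exists2 y, D r x y & D s y z)
  (D_near : forall r x, 0 < r -> \forall y \near x, D r x y)
  (D_loc : forall x, exists2 r, 0 < r & exists2 K, compact K & D r x `<=` K)
  (D_complete : forall u : nat -> T,
    (forall e, 0 < e -> exists N, forall i j, (N <= i)%N -> (N <= j)%N ->
      D e (u i) (u j)) ->
    exists p, forall e, 0 < e -> exists N, forall i, (N <= i)%N -> D e (u i) p).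

(** Failure of relative compactness of the ball, expressed with filters. *)
Let Bad x r := exists F : set_system T,
  [/\ ProperFilter F, F (D r x) & cluster F = set0].

Let D_refl r x : 0 < r -> D r x x.
Proof. by move=> r0; exact: nbhs_singleton (D_near x r0). Qed.

(* A cluster point of the midpoints between [x] and a divergent filter is the
   next centre. *)
Let step x r : 0 < r -> Bad x r ->
  exists2 x', D (3 / 4 * r) x x' & Bad x' (3 / 4 * r).
Proof.
(* If the smaller ball at [x] is bad, the centre need not move; otherwise every filter in it
   clusters, in particular that of the midpoints. *)
move=> r0 badx; have [b34|nbad] := pselect (Bad x (3 / 4 * r)).
  by exists x => //; apply: D_refl; lra.
have [F [FF FD F0]] := badx.
have r2 : 0 < r / 2 by lra.
have : forall q, exists y, D r x q -> D (r / 2) x y /\ D (r / 2) y q.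
  move=> q; have [xq|] := pselect (D r x q); last by exists q.
  have [|y xy yq] := @D_mid (r / 2) (r / 2) x q r2 r2; last by exists y.
  by rewrite -splitr.
case/choice => m mP.
have [x' clx'] : cluster (m @ F) !=set0.
  apply/set0P/eqP => cl0; apply: nbad; exists (m @ F); split=> //.
    exact: fmap_proper_filter.
  change (F (m @^-1` D (3 / 4 * r) x)); apply: filterS FD => q /mP[xm _].
  by apply: D_le xm; lra.
have r4 : 0 < r / 4 by lra.
(* Every large set of [F] contains a [q] whose midpoint is within [r / 4] of [x'] and within [r / 2]
   of [q], so [q] lies in the new ball. Hence the trace of [F] on that ball is proper. *)
have meet A : F A -> exists q, [/\ A q, D (r / 2) x (m q),
    D (r / 4) x' (m q) & D (3 / 4 * r) x' q].
  move=> FA.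
  have FB : (m @ F) (m @` (A `&` D r x)).
    change (F (m @^-1` (m @` (A `&` D r x)))).
    by apply: filterS (filterI FA FD) => q Aq; exists q.
  have [_ [[q [Aq /mP[xm mq]] <-] x'm]] := clx' _ _ FB (D_near x' r4).
  exists q; split=> //.
  by have := D_trans x'm mq; rewrite (_ : r / 4 + r / 2 = 3 / 4 * r) //; lra.
exists x'.
  have [q [_ xm /D_sym x'm _]] := meet _ FD.
  by have := D_trans xm x'm; rewrite (_ : r / 2 + r / 4 = 3 / 4 * r) //; lra.
exists (within (D (3 / 4 * r) x') F); split.
- apply: Build_ProperFilter_ex => A /meet[q [Aq _ _ x'q]].
  by exists q; exact: Aq.
- by rewrite /within /=; apply: filterS FD.
- rewrite -subset0 -F0 => z clz A B FA zB; apply: clz zB.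
  exact: filterS FA.
Qed.

Lemma bounded_cluster x r (F : set_system T) : ProperFilter F -> 0 < r ->
  F (D r x) -> cluster F !=set0.
Proof.
move=> FF r0 FD; apply/set0P/eqP => F0.
have badx : Bad x r by exists F.
have : forall xr : T * R, exists x', 0 < xr.2 -> Bad xr.1 xr.2 ->
    D (3 / 4 * xr.2) xr.1 x' /\ Bad x' (3 / 4 * xr.2).
  move=> [y s] /=; have [[s0 bady]|nb] := pselect (0 < s /\ Bad y s).
    by have [x' ? ?] := step s0 bady; exists x'.
  by exists y => s0 bady; exfalso; apply: nb.
case/choice => nxt nxtP.
pose rk k : R := (3 / 4) ^+ k * r.
have rk0 k : 0 < rk k by rewrite mulr_gt0 // exprn_gt0 //; lra.
have rkS k : rk k.+1 = 3 / 4 * rk k by rewrite /rk exprS mulrA.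
pose u := fix u k := if k is j.+1 then nxt (u j, rk j) else x.
have bad k : Bad (u k) (rk k).
  elim: k => [|k IH]; first by rewrite /rk expr0 mul1r.
  by rewrite rkS /=; have [] := nxtP (u k, rk k) (rk0 k) IH.
have uS k : D (rk k.+1) (u k) (u k.+1).
  by rewrite rkS /=; have [] := nxtP (u k, rk k) (rk0 k) (bad k).
(* The jumps add up to the geometric sum [3 * (rk k - rk (k + m))]; a further [rk k] is added so
   that the radius is positive when [m = 0]. *)
have ukm k m : D (4 * rk k - 3 * rk (k + m)%N) (u k) (u (k + m)%N).
  elim: m => [|m IH].
    by rewrite addn0; apply: D_refl; have := rk0 k; lra.
  rewrite addnS; have := D_trans IH (uS _); apply: D_le.
  by rewrite rkS; lra.
have uij i j : (i <= j)%N -> D (4 * rk i) (u i) (u j).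
  move=> /subnKC ij; have := ukm i (j - i)%N; rewrite ij; apply: D_le.
  by have := rk0 j; lra.
have small e : 0 < e -> exists N, forall i, (N <= i)%N -> rk i < e.
  move=> e0; have : rk k @[k --> \oo] --> (0 : R).
    rewrite -[X in _ --> X](mul0r r); apply: cvgM; last exact: cvg_cst.
    by apply: cvg_expr; rewrite ger0_norm; lra.
  move=> /cvgrPdist_lt/(_ _ e0)[N _ NP]; exists N => i Ni.
  by have := NP i Ni; rewrite sub0r normrN ger0_norm // ltW.
have [|p up] := D_complete (u := u).
  move=> e e0; have e4 : 0 < e / 4 by lra.
  have [N NP] := small _ e4; exists N => i j Ni Nj.
  have [ij|/ltnW ji] := leqP i j.
    by apply: D_le (uij _ _ ij); have := NP i Ni; lra.
  by apply: D_sym; apply: D_le (uij _ _ ji); have := NP j Nj; lra.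
(* For [k] large, the bad ball of stage [k] lies in a compact set around the limit, where its filter
   must cluster. *)
have [s s0 [K cK DK]] := D_loc p; have s2 : 0 < s / 2 by lra.
have [N1 N1P] := small _ s2; have [N2 N2P] := up _ s2.
pose k := maxn N1 N2.
have [F' [FF' F'D F'0]] := bad k.
have F'K : F' K.
  apply: filterS F'D => q uq; apply: DK.
  have := D_trans (D_sym (N2P k (leq_maxr _ _))) uq; apply: D_le.
  by have := N1P k (leq_maxl _ _); lra.
by have [q [_]] := cK F' FF' F'K; rewrite F'0.
Qed.

End HopfRinow.

(** * Integrals over segments *)

Section SegmentIntegral.
Context {R : realType}.
Notation mu := (@lebesgue_measure R).
Implicit Types (f F : R -> R) (a b : R).

Definition sint f a b : R := (\int[mu]_(t in `[a, b]) f t)%R.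

Lemma within_integrable f a b : {within `[a, b], continuous f} ->
  mu.-integrable `[a, b] (EFin \o f).
Proof.
by move=> cf; apply: continuous_compact_integrable => //; exact: segment_compact.
Qed.

Lemma sintE f a b : {within `[a, b], continuous f} ->
  (\int[mu]_(t in `[a, b]) (f t)%:E)%E = (sint f a b)%:E.
Proof.
move=> cf; rewrite /sint /Rintegral fineK //.
by apply: integrable_fin_num; [exact: measurable_itv|exact: within_integrable].
Qed.

Lemma sint_ge0 f a b : (forall t, 0 <= f t) -> 0 <= sint f a b.
Proof. by move=> f0; apply: Rintegral_ge0 => t _; exact: f0. Qed.

Lemma sint_split f a b t : {within `[a, b], continuous f} -> a <= t <= b ->
  sint f a b = sint f a t + sint f t b.
Proof.
move=> cf /andP[at_ tb]; rewrite /sint.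
have fi := within_integrable cf.
have := @Rintegral_itvB _ f (BLeft a) (BRight b) t fi.
rewrite !bnd_simp => /(_ at_ tb) /eqP; rewrite subr_eq addrC => /eqP ->.
congr (_ + _); apply: Rintegral_itv_obnd_cbnd.
apply: integrableS fi; rewrite ?measurable_itv //.
by apply: subset_itv; rewrite bnd_simp.
Qed.

Lemma sint_ivt f a b l : a <= b -> {within `[a, b], continuous f} ->
  0 <= l <= sint f a b -> exists2 t, a <= t <= b & sint f a t = l.
Proof.
move=> ab cf l0; have fi := within_integrable cf.
have cF := parameterized_integral_continuous ab fi.
have Fa : parameterized_integral mu a a f = 0.
  by rewrite /parameterized_integral set_itv1 Rintegral_set1.
have [|t] := IVT ab cF (v := l).
  rewrite Fa; have : 0 <= sint f a b by case/andP: l0 => /le_trans h /h.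
  by rewrite -/(sint f a b) => sp; rewrite min_l ?max_r.
by rewrite in_itv /= => tab <-; exists t.
Qed.

(** [C * I - F], with [I] the primitive of [f], has a nonnegative derivative. Comparing derivatives
    avoids integrating [derive1 F], whose continuity is not assumed. *)
Lemma sint_ge_increment f F a b (C : R) : a <= b ->
  {within `[a, b], continuous f} ->
  (forall t, t \in `]a, b[ -> {for t, continuous f}) ->
  {within `[a, b], continuous F} ->
  (forall t, t \in `]a, b[ -> derivable F t 1 /\ derive1 F t <= C * f t) ->
  F b - F a <= C * sint f a b.
Proof.
move=> ab cf cfo cF dF; have fi := within_integrable cf.
pose I x := parameterized_integral mu a x f.
have cI : {within `[a, b], continuous I} := parameterized_integral_continuous ab fi.
have Fa : I a = 0.
  by rewrite /I /parameterized_integral set_itv1 Rintegral_set1.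
have dI t : t \in `]a, b[ -> derivable I t 1 /\ derive1 I t = f t.
  move=> tab; have := tab; rewrite in_itv /= => /andP[at_ tb].
  by have := continuous_FTC1_closed tb fi at_ (cfo t tab).
have Ib : I b = sint f a b by [].
move: (I) cI Fa dI Ib => {}I cI Fa dI Ib.
pose H : R -> R := (C \*: (I : R -> R^o) : R -> R^o) - F.
have HE x : H x = C * I x - F x by [].
have dH t : t \in `]a, b[ -> derivable H t 1 /\ 0 <= derive1 H t.
  move=> tab; have [dIt It] := dI t tab; have [dFt Ft] := dF t tab.
  have dCI := @derivableZ _ _ _ _ C _ _ dIt.
  split; first exact: derivableB dCI dFt.
  rewrite derive1E (deriveB dCI dFt) (@deriveZ _ _ _ _ C _ _ dIt) -!derive1E It.
  by rewrite subr_ge0.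
have cH : {within `[a, b], continuous H}.
  move=> x; apply: cvgB; last exact: cF.
  by apply: cvgM; [exact: cvg_cst|exact: cI].
have := @ger0_derive1_ndecr R H a b (fun t tab => (dH t tab).1)
  (fun t tab => (dH t tab).2) cH a b (lexx _) ab (lexx _).
by rewrite !HE Fa mulr0 sub0r Ib; lra.
Qed.

Lemma sint_le f a b (C : R) : a <= b -> {within `[a, b], continuous f} ->
  (forall t, t \in `[a, b] -> f t <= C) -> sint f a b <= C * (b - a).
Proof.
move=> ab cf fC.
have <- : sint (cst C) a b = C * (b - a).
  rewrite /sint Rintegral_cst //= lebesgue_measure_itv /= lte_fin.
  by move: ab; rewrite le_eqVlt => /predU1P[->|->] //=; rewrite ltxx subrr.
rewrite /sint; apply: le_Rintegral => //.
- exact: within_integrable.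
- by apply: within_integrable => x; exact: cvg_cst.
Qed.

Lemma sint_opp f a b : a <= b -> {within `[a, b], continuous f} ->
  sint (f \o -%R) (- b) (- a) = sint f a b.
Proof.
move=> ab cf; have := @integration_by_substitution_oppr R f (- b) (- a).
by rewrite !opprK lerN2 /sint /Rintegral => /(_ ab cf) <-.
Qed.

End SegmentIntegral.

(** * Riemannian distance *)

Section SmoothInto.
Context {R : realType} {n : nat} {M : manifold R n}.

Lemma smooth_intoS (V : normedModType R) (U U' : set V) (h : V -> M) :
  U' `<=` U -> smooth_into U h -> smooth_into U' h.
Proof.
move=> UU' [ch sh]; split=> [x /UU'|d ad k]; first exact: ch.
by apply: Ck_onS (sh d ad k) => x [/UU'].
Qed.

Lemma smooth_into_affine (V V' : normedModType R) (U : set V') (h : V' -> M)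
    (a : V -> V') (l : V -> V') :
  (forall x v (r : R), a (r *: v + x) = r *: l v + a x) ->
  (forall x, differentiable a x) ->
  smooth_into U h -> smooth_into (a @^-1` U) (h \o a).
Proof.
move=> al da [ch sh]; split=> [x Ux|d ad k].
  by apply: continuous_comp; [exact: differentiable_continuous|exact: ch].
exact: (Ck_on_affine al da (sh d ad k)).
Qed.

Lemma cinv_smooth_into (d : chart R n M) : atlas M d ->
  smooth_into (img d) (cinv d).
Proof.
move=> ad; split=> [x dx|e ae k]; first exact: cinv_cont.
by have := transition_smooth ad ae k; rewrite overlapE.
Qed.

Lemma smooth_into_diff (V : normedModType R) (U : set V) (h : V -> M) d x :
  smooth_into U h -> atlas M d -> U x -> dom d (h x) ->
  differentiable (coord d \o h) x.
Proof. by move=> [_ sh] ad Ux dx; have [+ _] := sh d ad 1%N; apply. Qed.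

End SmoothInto.

Section Curves.
Context {R : realType} {n : nat} {M : manifold R n} (G : riemannian_metric M).
Implicit Types (d : chart R n M) (O : set R^o) (c : R -> M) (a b t : R).

Definition speed c t : R := rnorm G (c t) (velocity c t).

Lemma speed_ge0 c t : 0 <= speed c t. Proof. exact: sqrtr_ge0. Qed.

(** [velocity] reads the curve in [chart_at (c t)], which changes with [t]; in a fixed chart the
    dependence on [t] becomes regular, and continuity of the speed rests on this. *)
Lemma velocityE O c d t : smooth_into O c -> atlas M d -> O t -> dom d (c t) ->
  velocity c t = tvec d (c t) (derive1 (coord d \o c) t).
Proof.
move=> sc ad Ot dt; rewrite /velocity !derive1E.
apply: (@derive_chart_change _ _ _ R^o c) => //.
- exact: chart_at_atlas.
- exact: chart_at_dom.
- exact: sc.1.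
- exact: smooth_into_diff sc ad Ot dt.
Qed.

Lemma curve_derive_continuous O c d t : smooth_into O c -> atlas M d ->
  O t -> dom d (c t) -> {for t, continuous (derive1 (coord d \o c))}.
Proof.
move=> [_ sc] ad Ot dt; have [_ /(_ 1)] := sc d ad 1%N.
move=> /(_ t (conj Ot dt)).
suff <- : derive1 (coord d \o c) = 'D_1 (coord d \o (c : R^o -> M)) by [].
by apply/funext => s; rewrite derive1E.
Qed.

Lemma speedE O c d t : smooth_into O c -> atlas M d -> O t -> dom d (c t) ->
  speed c t = Num.sqrt (mx_form (fun i j s => gram G d i j (coord d (c s))) t
    (derive1 (coord d \o c) t) (derive1 (coord d \o c) t)).
Proof.
move=> sc ad Ot dt; rewrite /speed /rnorm (velocityE sc ad Ot dt).
by have := gramE G _ _ ad (img_coord dt); rewrite coordK // => ->.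
Qed.

Lemma speed_continuous O c t : open O -> smooth_into O c -> O t ->
  {for t, continuous (speed c)}.
Proof.
move=> oO sc Ot; pose d := chart_at (c t).
have ad : atlas M d := chart_at_atlas _.
have dt : dom d (c t) := chart_at_dom _.
have ct : {for t, continuous c} by exact: sc.1.
pose q s : R := mx_form (fun i j s => gram G d i j (coord d (c s))) s
    (derive1 (coord d \o c) s) (derive1 (coord d \o c) s).
have speedq : \forall s \near t, Num.sqrt (q s) = speed c s.
  have nO : \forall s \near t, O s by exact: open_nbhs_nbhs.
  apply: filterS2 nO (near_preim ct (near_dom dt)) => s Os ds.
  by rewrite (speedE sc ad Os ds).
have cq : {for t, continuous q}.
  have cd := curve_derive_continuous sc ad Ot dt.
  apply: continuous_form => // i j.
  apply: (@continuous_comp _ _ _ (coord d \o c)); last first.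
    exact: gram_continuous (img_coord dt).
  exact: continuous_comp ct (coord_cont dt).
rewrite /prop_for /continuous_at -(nbhs_singleton speedq).
apply: cvg_trans (near_eq_cvg speedq) _.
by apply: (@continuous_comp _ _ _ q Num.sqrt) => //; exact: sqrt_continuous.
Qed.

Lemma speed_within O c a b : open O -> smooth_into O c -> `[a, b] `<=` O ->
  {within `[a, b], continuous (speed c)}.
Proof.
move=> oO sc abO; apply: continuous_in_subspaceT => t; rewrite inE => /abO.
exact: speed_continuous.
Qed.

Definition rlen p q (l : R) : Prop := curve_length G p q l%:E.

Lemma rlen0 p : rlen p p 0. Proof. exact: curve_length_nil. Qed.

Lemma rlen_cons c a b O q l : a <= b -> open O -> `[a, b] `<=` O ->
  smooth_into O c -> rlen (c b) q l ->
  rlen (c a) q (sint (speed c) a b + l).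
Proof.
move=> ab oO abO sc cl; rewrite /rlen EFinD -sintE; last exact: speed_within sc abO.
exact: (curve_length_cons ab oO abO sc cl).
Qed.

Lemma rlen_segment c a b O : a <= b -> open O -> `[a, b] `<=` O ->
  smooth_into O c -> rlen (c a) (c b) (sint (speed c) a b).
Proof.
by move=> ab oO abO sc; rewrite -[sint _ _ _]addr0; exact: rlen_cons sc (rlen0 _).
Qed.

(** Continuity of the speed makes each integral finite, so an induction on [curve_length] can be
    carried out with real lengths. *)
Lemma curve_length_rect (P : M -> M -> R -> Prop) :
  (forall p, P p p 0) ->
  (forall c a b O q l, a <= b -> open O -> `[a, b] `<=` O -> smooth_into O c ->
     rlen (c b) q l -> P (c b) q l -> P (c a) q (sint (speed c) a b + l)) ->
  forall p q L, curve_length G p q L ->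
  exists l : R, [/\ L = l%:E, rlen p q l & P p q l].
Proof.
move=> P0 Pc p q L; elim=> [p'|c a b O q' L' ab oO abO sc _ [l [-> rl Pl]]].
  by exists 0; split=> //; exact: rlen0.
exists (sint (speed c) a b + l); split.
- by rewrite EFinD -sintE //; exact: speed_within sc abO.
- exact: rlen_cons sc rl.
- exact: Pc sc rl Pl.
Qed.

Lemma rlen_rect (P : M -> M -> R -> Prop) :
  (forall p, P p p 0) ->
  (forall c a b O q l, a <= b -> open O -> `[a, b] `<=` O -> smooth_into O c ->
     rlen (c b) q l -> P (c b) q l -> P (c a) q (sint (speed c) a b + l)) ->
  forall p q l, rlen p q l -> P p q l.
Proof. by move=> P0 Pc p q l /(curve_length_rect P0 Pc)[l' [[->] _]]. Qed.

Lemma rlen_trans p q s l m : rlen p q l -> rlen q s m -> rlen p s (l + m).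
Proof.
move=> pq; elim/rlen_rect: pq s m => [p'|c a b O q' l' ab oO abO sc _ IH] s m qs.
  by rewrite add0r.
by rewrite -addrA; apply: rlen_cons sc _ => //; exact: IH.
Qed.

(** Each segment is run backwards by [-%R], which changes the sign of its velocity and not its
    speed. *)
Lemma rlen_sym p q l : rlen p q l -> rlen q p l.
Proof.
elim/rlen_rect => [p'|c a b O q' l' ab oO abO sc _ IH]; first exact: rlen0.
rewrite addrC; apply: rlen_trans IH _.
have oppl (x v : R^o) (r : R) : - (r *: v + x) = r *: (- v) + - x.
  by rewrite opprD scalerN.
have diffo (x : R^o) : differentiable (-%R : R^o -> R^o) x by [].
have sc' := smooth_into_affine oppl diffo sc.
have oO' : open (-%R @^-1` O : set R^o).
  by apply: open_comp => // x _; exact: opp_continuous.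
have baO' : `[- b, - a] `<=` (-%R @^-1` O).
  by move=> t /=; rewrite in_itv /= => tba; apply: abO; rewrite /= in_itv /=; lra.
have ba : - b <= - a by rewrite lerN2.
have := rlen_segment ba oO' baO' sc'; rewrite /= !opprK.
suff -> : sint (speed (c \o -%R)) (- b) (- a) = sint (speed c) a b by exact.
transitivity (sint (speed c \o -%R) (- b) (- a)); last first.
  exact: sint_opp ab (speed_within oO sc abO).
apply: eq_Rintegral => t tba /=.
have Ot : O (- t) by apply: baO'; rewrite inE in tba.
have dt : dom (chart_at (c (- t))) (c (- t)) := chart_at_dom _.
have at_ : atlas M (chart_at (c (- t))) := chart_at_atlas _.
rewrite /speed /velocity /=.
have -> : derive1 (coord (chart_at (c (- t))) \o (c \o -%R)) t =
    - derive1 (coord (chart_at (c (- t))) \o c) (- t).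
  have df := @smooth_into_diff _ _ _ R^o O c _ (- t) sc at_ Ot dt.
  rewrite !derive1E.
  transitivity ('D_(-1) (coord (chart_at (c (- t))) \o c) (- t : R^o)).
    exact: (derive_comp_affine (coord (chart_at (c (- t))) \o c) _ _ oppl).
  by rewrite !deriveE // linearN.
exact: (fnormN (inner_sb G _)).
Qed.

(** The curve is cut where it has travelled a suitable length: beyond the first segment if that one
    is shorter than [r], otherwise inside it, by the intermediate value theorem. *)
Lemma rlen_mid p q l r s : rlen p q l -> 0 < r -> 0 < s -> l < r + s ->
  exists y l1 l2, [/\ rlen p y l1, rlen y q l2, l1 < r & l2 < s].
Proof.
move=> pq; elim/rlen_rect: pq r s => [p'|c a b O q' l' ab oO abO sc rl IH] r s r0 s0.
  by move=> _; exists p', 0, 0; split=> //; exact: rlen0.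
move=> lrs; have cs := speed_within oO sc abO.
have S0 := @sint_ge0 _ _ a b (speed_ge0 c).
have [Sr|rS] := ltrP (sint (speed c) a b) r.
  have [|||y [l1 [l2 [h1 h2 h3 h4]]]] := IH (r - sint (speed c) a b) s; try lra.
  exists y, (sint (speed c) a b + l1), l2; split=> //; last by lra.
  exact: rlen_cons sc h1.
(* The midpoint between the total length minus [s] and [r]: a cut there leaves less than [r] before
   it and less than [s] after it. The maximum keeps it nonnegative. *)
pose tau := Num.max 0 ((sint (speed c) a b + l' - s + r) / 2).
have tau0 : 0 <= tau by rewrite /tau le_max lexx.
have taur : tau < r by rewrite /tau gt_max r0 /=; lra.
have taum : (sint (speed c) a b + l' - s + r) / 2 <= tau.
  by rewrite /tau le_max lexx orbT.
have [|t tab tE] := sint_ivt ab cs (l := tau); first by rewrite tau0 /=; lra.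
have := sint_split cs tab; rewrite tE => Ssplit.
have /andP[at_ tb] := tab.
exists (c t), tau, (sint (speed c) t b + l'); split=> //.
- rewrite -tE; apply: (rlen_segment at_ oO _ sc).
  by apply: subset_trans abO; apply: subset_itv; rewrite bnd_simp.
- apply: (rlen_cons tb oO _ sc rl).
  by apply: subset_trans abO; apply: subset_itv; rewrite bnd_simp.
- lra.
Qed.

(** A strict bound on an infimum is witnessed by an actual curve; hence the relation [D] is
    instantiated with this strict inequality. *)
Lemma rdist_ltP p q (r : R) :
  (rdist G p q < r%:E)%E <-> exists2 l, rlen p q l & l < r.
Proof.
split=> [/ereal_inf_lt[L /= pqL Lr]|[l pql lr]].
  have [l [LE pql _]] := curve_length_rect (P := fun _ _ _ => True)
    (fun=> I) (fun _ _ _ _ _ _ _ _ _ _ _ _ => I) pqL.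
  by exists l => //; rewrite -lte_fin -LE.
apply: (@le_lt_trans _ _ l%:E); last by rewrite lte_fin.
exact: ereal_inf_lbound.
Qed.

End Curves.

(** * Riemannian distance and the topology of the manifold *)

Section RdistTopology.
Context {R : realType} {n : nat} {M : manifold R n} (G : riemannian_metric M).

(* The straight segment in a chart bounds the distance from above. *)
Lemma rdist_near (p : M) (r : R) : 0 < r ->
  \forall q \near p, (rdist G p q < r%:E)%E.
Proof.
move=> r0; pose d := chart_at p; pose x := coord d p.
have ad : atlas M d := chart_at_atlas _.
have dp : dom d p := chart_at_dom _.
have [a [b [_ b0 /nbhs_ballP[e /= e0 eb]]]] :=
  metric_comparable G ad (img_coord dp).
(* [e] keeps the segment where the metric is comparable to the norm, and [r / b] makes its length,
   at most [b * |w|], less than [r]. *)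
have be0 : 0 < Num.min e (r / b) by rewrite lt_min e0 divr_gt0.
have nx : \forall q \near p, ball x (Num.min e (r / b)) (coord d q).
  by apply: near_coord dp _; exact: nbhsx_ballx.
apply: filterS2 (near_dom dp) nx => q dq xq.
pose w : 'rV[R]_n := coord d q - x.
have : `|w| < Num.min e (r / b).
  by rewrite /w distrC; move: xq; rewrite -ball_normE.
rewrite lt_min => /andP[we wr].
pose l (t : R^o) : 'rV[R]_n := t *: w + x.
have la (t v : R^o) (s : R) : l (s *: v + t) = s *: (v *: w) + l t.
  by rewrite /l scalerDl addrA scalerA.
have dl (t : R^o) : differentiable l t.
  by apply: differentiableD => //; exact: differentiable_cst.
have lball t : 0 <= t <= 1 -> ball x e (l t).
  rewrite -ball_normE /= /l => /andP[t0 t1].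
  rewrite opprD addrCA subrr addr0 normrN normrZ ger0_norm //.
  by apply: le_lt_trans we; rewrite ler_piMl.
pose O : set R^o := l @^-1` img d.
have oO : open O.
  apply: open_comp; last exact: img_open.
  by move=> t _; exact: differentiable_continuous.
have O01 : `[0, 1] `<=` O by move=> t /=; rewrite in_itv /= => /lball/eb[].
have sc := smooth_into_affine la dl (cinv_smooth_into ad).
have seg := rlen_segment G (@ler01 R) oO O01 sc.
have E0 : (cinv d \o l) 0 = p by rewrite /= /l scale0r add0r /x coordK.
have E1 : (cinv d \o l) 1 = q by rewrite /= /l scale1r /w subrK coordK.
rewrite E0 E1 in seg.
apply/rdist_ltP; exists (sint (speed G (cinv d \o l)) 0 1) => //.
apply: (@le_lt_trans _ _ (b * `|w| * (1 - 0))); last first.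
  by rewrite subr0 mulr1 mulrC -ltr_pdivlMr.
apply: sint_le => //; first exact: speed_within oO sc O01.
move=> t t01; have Ot : O t by exact: O01.
have {}t01 : 0 <= t <= 1 by move: t01; rewrite in_itv.
have [dt _] := cinv_img Ot.
rewrite /speed (velocityE sc ad Ot dt).
have -> : derive1 (coord d \o (cinv d \o l)) t = w.
  rewrite derive1E.
  transitivity ('D_1 l (t : R^o)).
    apply: near_eq_derive; have : \forall s \near t, O s by exact: open_nbhs_nbhs.
    by apply: filterS => s /cinv_img[].
  by rewrite (derive_affine _ _ la) scale1r.
by have [_ /(_ w)/andP[_ ub]] := eb _ (lball t t01); exact: ub.
Qed.

(** Squaring makes the positive part differentiable at 0, as needed where a cut-off reaches zero. *)
Definition sqpos (u : R) : R := Num.max 0 u ^+ 2.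

Lemma is_derive_sqpos u : is_derive u (1 : R) sqpos (2 * Num.max 0 u).
Proof.
have [u0|u0|u0] := ltgtP 0 u.
- apply: (@near_eq_is_derive R R^o R^o ((@GRing.exp R)^~ 2)).
    near=> v; rewrite /sqpos max_r // ltW //; near: v.
    by apply: open_nbhs_nbhs; split=> //; exact: open_gt.
  split; first exact: exprn_derivable.
  by rewrite -derive1E exp_derive1 expr1.
- apply: (@near_eq_is_derive R R^o R^o (cst 0)).
    near=> v; rewrite /sqpos max_l ?expr0n // ltW //; near: v.
    by apply: open_nbhs_nbhs; split=> //; exact: open_lt.
  by rewrite mulr0; exact: is_derive_cst.
- have H : (fun h : R => h^-1 *: ((sqpos \o shift 0) (h *: 1) - sqpos 0)) @ 0^'
      --> (0 : R).
    rewrite /sqpos /shift /= maxxx expr0n /=.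
    apply/cvgrPdist_lt => e e0; near=> h.
    rewrite sub0r normrN subr0 addr0 [h *: 1]mulr1 normrZ normfV.
    have h0 : h != 0 by near: h; exact: nbhs_dnbhs_neq.
    rewrite ltr_pdivrMl ?normr_gt0 //.
    have : `|h| < e by near: h; exact: dnbhs0_lt.
    move=> he; apply: (@le_lt_trans _ _ (`|h| * `|h|)).
      rewrite normrX expr2; apply: ler_pM => //;
        by case: (leP 0 h) => // _; rewrite normr0.
    by rewrite ltr_pM2l // normr_gt0.
  by rewrite -u0 mulr0; split; [apply/cvg_ex; exists 0|exact: cvg_lim].
Unshelve. all: by end_near. Qed.

(* A [C^1] cut-off supported in a compact chart ball is Lipschitz along curves,
   so a point close to [p] has a positive cut-off and lies in that ball. *)
Lemma rdist_locally_compact (p : M) : exists2 r : R, 0 < r &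
  exists2 K, compact K & forall q, (rdist G p q < r%:E)%E -> K q.
Proof.
pose d := chart_at p; pose x := coord d p.
have ad : atlas M d := chart_at_atlas _.
have dp : dom d p := chart_at_dom _.
have [a [b [a0 _ /nbhs_ballP[e /= e0 ea]]]] :=
  metric_comparable G ad (img_coord dp).
pose rr := e / 2; have rr0 : 0 < rr by rewrite divr_gt0.
(* The squared Euclidean distance in the chart, which is differentiable, unlike the sup norm. *)
pose s (z : 'rV[R]_n) : R := \sum_i (z 0 i - x 0 i) ^+ 2.
have coord_le z i : s z <= rr ^+ 2 -> `|z 0 i - x 0 i| <= rr.
  move=> sz; rewrite -(@ler_pXn2r _ 2) ?nnegrE ?(ltW rr0) //.
  rewrite real_normK ?num_real //; apply: le_trans sz.
  by rewrite /s (bigD1 i) //= lerDl sumr_ge0 // => j _; exact: sqr_ge0.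
have sball z : s z <= rr ^+ 2 -> ball x e z.
  move=> sz; rewrite -ball_normE /=; apply: (@le_lt_trans _ _ rr); last first.
    by rewrite /rr; lra.
  rewrite [leLHS]/Num.Def.normr/= mx_normrE; apply: bigmax_le; first exact: ltW.
  by move=> [i j] _ /=; rewrite !mxE distrC !ord1; exact: coord_le.
have cs : continuous s.
  move=> z; apply: for_continuous_sum => i.
  have ci : {for z, continuous (fun z : 'rV[R]_n => z 0 i - x 0 i)}.
    exact: (continuousB (@coord_continuous R 1 n 0 i z)
      (@cst_continuous _ _ (x 0 i) z)).
  by rewrite /prop_for /continuous_at; exact: (cvgM ci ci).
pose E := [set z | s z <= rr ^+ 2].
have cE : compact E.
  apply: bounded_closed_compact.
    exists (`|x| + e); split; first by rewrite num_real.
    move=> N xeN z /sball; rewrite -ball_normE /= => xz.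
    apply: le_trans (ltW xeN); rewrite -[z](subKr x).
    by apply: le_trans (ler_normB _ _) _; rewrite lerD2l ltW.
  rewrite (_ : E = s @^-1` [set u | u <= rr ^+ 2]) //.
  by apply: closed_comp => [z _|]; [exact: cs|exact: closed_le].
have Eimg z : E z -> img d z by move=> /sball/ea[].
pose K := cinv d @` E.
have cK : compact K.
  apply: continuous_compact => //; apply: continuous_in_subspaceT => z.
  by rewrite inE => /Eimg; exact: cinv_cont.
(* Closedness allows the extension of the cut-off by zero: around a point outside the chart it
   vanishes identically. *)
have clK : closed K by apply: compact_closed => //; exact: manifold_hausdorff.
pose psi (y : M) := if `[< dom d y >] then sqpos (rr ^+ 2 - s (coord d y)) else 0.
have psip : psi p = rr ^+ 4.
  rewrite /psi asboolT // /s big1 ?subr0 => [|i _]; last by rewrite subrr expr0n.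
  by rewrite /sqpos max_r ?sqr_ge0 // -exprM.
have psiK y : psi y != 0 -> K y.
  rewrite /psi; case: asboolP => [dy|]; last by rewrite eqxx.
  rewrite /sqpos; case: (leP 0 (rr ^+ 2 - s (coord d y))) => [h _|_].
    by exists (coord d y); [rewrite /E /=; lra|exact: coordK].
  by rewrite expr0n eqxx.
(* Along a curve, the derivative of the cut-off is at most [2 * rr ^ 2] times a sum of [n] terms
   bounded by [2 * rr * speed / a]; the [+ 1] keeps [C] positive when [n = 0]. *)
pose C := 4 * rr ^+ 2 * (n%:R * rr / a) + 1.
have C0 : 0 < C.
  have q0 : 0 <= n%:R * rr / a 
    by apply: divr_ge0; [apply: mulr_ge0; [exact: ler0n|exact: ltW]|exact: ltW].
  have q1 : 0 <= 4 * rr ^+ 2 by apply: mulr_ge0 => //; exact: sqr_ge0.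
  by have := mulr_ge0 q1 q0; rewrite /C; lra.
have main : forall p q l, rlen G p q l -> psi p - psi q <= C * l.
  apply: (@rlen_rect _ _ _ G (fun p q l => psi p - psi q <= C * l)).
    by move=> q; rewrite mulr0 subrr.
  move=> c a' b' O q l ab oO abO sc _ IH.
  suff : - psi (c b') - - psi (c a') <= C * sint (speed G c) a' b' by lra.
  have dpsi t : O t -> derivable (fun t => - psi (c t)) t 1 /\
      derive1 (fun t => - psi (c t)) t <= C * speed G c t.
    move=> Ot; have ct : {for t, continuous c} by exact: sc.1.
    have Csp : 0 <= C * speed G c t by rewrite mulr_ge0 ?(ltW C0) ?speed_ge0.
    have [dt|ndt] := pselect (dom d (c t)); last first.
      have nK : \forall y \near c t, psi y = 0.
        have oK : open (~` K) by rewrite openC.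
        have nKt : ~ K (c t).
          by move=> [z /Eimg/cinv_img[dz _] ctE]; apply: ndt; rewrite -ctE.
        apply: filterS (open_nbhs_nbhs (conj oK nKt)) => y Ky.
        by apply/eqP/negPn/negP => /psiK.
      suff [h1 h2] : is_derive t (1 : R) (fun t => - psi (c t)) 0.
        by rewrite derive1E h2.
      apply: near_eq_is_derive (is_derive_cst (0 : R) t 1).
      by apply: filterS (near_preim ct nK) => y ->; rewrite oppr0.
    pose X := coord d \o c; have dX : differentiable X t.
      exact: (@smooth_into_diff _ _ _ R^o O c).
    pose X' := derive1 X t.
    have dXi i : is_derive (t : R^o) (1 : R^o) (fun u => X u 0 i : R^o) (X' 0 i).
      have dX1 : derivable X t 1 by exact: diff_derivable.
      split; first exact: ((@derivable_mxP _ R^o _ _ _ _ _).1 dX1 0 i).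
      by rewrite /X' derive1E derive_mx // mxE.
    have ds : is_derive (t : R^o) (1 : R^o) (fun u => rr ^+ 2 - s (X u) : R^o)
        (- \sum_i 2 * (X t 0 i - x 0 i) * X' 0 i).
      have dsq i : is_derive (t : R^o) (1 : R^o)
          (fun u => (X u 0 i - x 0 i) ^+ 2 : R^o) (2 * (X t 0 i - x 0 i) * X' 0 i).
        have dB : is_derive (t : R^o) (1 : R^o) (fun u => X u 0 i - x 0 i : R^o) (X' 0 i).
          have := is_deriveB (dXi i) (is_derive_cst (x 0 i : R^o) _ _).
          by rewrite subr0.
        exact: is_derive_eq (is_deriveX 2 dB) _.
      have := is_deriveB (is_derive_cst (rr ^+ 2 : R^o) _ _) (is_derive_sum dsq).
      rewrite sub0r; congr is_derive.
      by apply/funext => u; rewrite !fctE fct_sumE.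
    have dF : is_derive (t : R^o) (1 : R^o) (fun t => - psi (c t))
       (2 * Num.max 0 (rr ^+ 2 - s (X t)) * \sum_i 2 * (X t 0 i - x 0 i) * X' 0 i).
      have := is_deriveN (is_derive1_comp (is_derive_sqpos _) ds).
      rewrite mulrN opprK => dcomp; apply: near_eq_is_derive dcomp.
      apply: filterS (near_preim ct (near_dom dt)) => u du.
      by rewrite /psi asboolT.
    case: dF => h1 h2; split=> //; rewrite derive1E h2.
    have [sX|sX] := ltrP 0 (rr ^+ 2 - s (X t)); last first.
      by rewrite mulr0 mul0r.
    have EX : E (X t) by rewrite /E /=; lra.
    have X'le : `|X'| <= speed G c t / a.
      rewrite ler_pdivlMr // mulrC /speed (velocityE sc ad Ot dt).
      have [_ /(_ X')/andP[+ _]] := ea _ (sball _ EX).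
      by rewrite /X /= coordK.
    have sum_le : \sum_i 2 * (X t 0 i - x 0 i) * X' 0 i <=
        n%:R * (2 * rr * (speed G c t / a)).
      rewrite -[leRHS](_ : \sum_(i < n) 2 * rr * (speed G c t / a) = _); last first.
        by rewrite sumr_const card_ord -[LHS]mulr_natl.
      apply: ler_sum => i _; apply: (le_trans (ler_norm _)).
      rewrite !normrM normr_nat; apply: ler_pM; rewrite ?mulr_ge0 //.
        by rewrite ler_wpM2l //; exact: coord_le.
      by apply: le_trans X'le; exact: mx_coord_le.
    apply: (@le_trans _ _ (2 * rr ^+ 2 * (n%:R * (2 * rr * (speed G c t / a))))).
      have s0 : 0 <= s (X t) by apply: sumr_ge0 => i _; exact: sqr_ge0.
      apply: le_trans (_ : 2 * (rr ^+ 2 - s (X t)) *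
        (n%:R * (2 * rr * (speed G c t / a))) <= _).
        by rewrite ler_wpM2l // mulr_ge0 // ltW.
      apply: ler_wpM2r; last by rewrite ler_wpM2l // lerBlDr lerDl.
      apply: mulr_ge0 => //; apply: mulr_ge0.
        by apply: mulr_ge0 => //; exact: ltW.
      by apply: divr_ge0; [exact: speed_ge0|exact: ltW].
    rewrite /C mulrDl mul1r -subr_ge0 (_ : _ - _ = speed G c t) ?speed_ge0 //.
    by field; rewrite gt_eqF.
  have ooO t : t \in `]a', b'[ -> O t.
    by move=> tab; apply: abO; apply: subset_itv_oo_cc.
  apply: (@sint_ge_increment R (speed G c) (fun t => - psi (c t)) a' b' C ab).
  - exact: speed_within oO sc abO.
  - by move=> t /ooO; exact: speed_continuous.
  - apply: continuous_in_subspaceT => t; rewrite inE => /abO/dpsi[+ _].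
    by move=> /derivable1_diffP/differentiable_continuous.
  - by move=> t /ooO; exact: dpsi.
(* The cut-off equals [rr ^ 4] at [p] and drops by at most [C] times the length, so it is still
   positive within this distance. *)
exists (rr ^+ 4 / C); first by rewrite divr_gt0 // exprn_gt0.
exists K => // q /rdist_ltP[l /main + lr]; rewrite psip => h.
apply: psiK; rewrite gt_eqF //.
by move: lr; rewrite ltr_pdivlMr // => lr; lra.
Qed.

End RdistTopology.

Lemma rbounded_cluster (R : realType) (n : nat) (M : manifold R n)
    (G : riemannian_metric M) (A : set M) (u : nat -> M) :
  rcomplete G -> rbounded G A -> (forall k, A (u k)) ->
  exists z, cluster (u @ \oo) z.
Proof.
move=> Gc [C AC] uA.
have C1 : 0 < `|C| + 1 :> R by rewrite ltr_wpDl.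
apply: (@bounded_cluster R M (fun r p q => (rdist G p q < r%:E)%E) _ _ _ _ _ _ _
  (u 0%N) (`|C| + 1)) => //.
- by move=> r s p q rs /lt_le_trans; apply; rewrite lee_fin.
- move=> r p q /rdist_ltP[l pql lr]; apply/rdist_ltP; exists l => //.
  exact: rlen_sym.
- move=> r s p q z /rdist_ltP[l pql lr] /rdist_ltP[l' qzl ls].
  apply/rdist_ltP; exists (l + l'); first exact: rlen_trans qzl.
  exact: ltrD.
- move=> r s p q r0 s0 /rdist_ltP[l pql lrs].
  have [y [l1 [l2 [h1 h2 h3 h4]]]] := rlen_mid pql r0 s0 lrs.
  by exists y; apply/rdist_ltP; [exists l1|exists l2].
- by move=> r p; exact: rdist_near.
- move=> p; have [r r0 [K cK DK]] := rdist_locally_compact G p.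
  by exists r => //; exists K.
- exists 0%N => // k _ /=; apply: le_lt_trans (AC _ _ (uA 0%N) (uA k)) _.
  by rewrite lte_fin; apply: le_lt_trans (ler_norm C) _; rewrite ltrDl.
Qed.

(** * Second-order calculus *)

Lemma two_limits_close (R : realType) (t a b d e : R) : 0 < t ->
  `|d - t * (t * b)| <= t * (t * (e / 2)) ->
  `|d - t * (t * a)| <= t * (t * (e / 2)) -> `|a - b| <= e.
Proof.
move=> t0 h1 h2; have tt0 : 0 < t * t by rewrite mulr_gt0.
rewrite -(ler_pM2l tt0) -{1}[t * t]gtr0_norm // -normrM.
have -> : t * t * (a - b) = d - t * (t * b) - (d - t * (t * a)) by ring.
by apply: (le_trans (ler_normB _ _)); apply: le_trans (lerD h1 h2) _; lra.
Qed.

Section SecondOrder.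
Context {R : realType} {V : normedModType R}.
Implicit Types (h : V -> R^o) (U : set V) (x y u v w s : V).

Lemma derive_lin h x (a : R) u v : differentiable h x ->
  'D_(a *: u + v) h x = a * 'D_u h x + 'D_v h x.
Proof. by move=> dh; rewrite !deriveE // linearP. Qed.

Lemma line_affine y s (t v : R^o) (r : R) :
  (r *: v + t) *: s + y = r *: (v *: s) + (t *: s + y).
Proof. by rewrite scalerDl scalerA addrA. Qed.

Lemma line_differentiable y s (t : R^o) :
  differentiable (fun t : R^o => t *: s + y) t.
Proof. by apply: differentiableD => //; exact: differentiable_cst. Qed.

Lemma is_derive_line h y s (t : R) : differentiable h (t *: s + y) ->
  is_derive (t : R^o) (1 : R^o) (fun t : R^o => h (t *: s + y)) ('D_s h (t *: s + y)).
Proof.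
move=> dh; have al := line_affine y s.
split; last first.
  by rewrite (derive_comp_affine h _ _ al) scale1r.
apply: diff_derivable.
exact: (@differentiable_comp _ _ _ _ (fun t : R^o => t *: s + y) h t
  (line_differentiable _ _ _) dh).
Qed.

Lemma mvt_line h y s (t : R) : 0 <= t ->
  (forall a, 0 <= a <= t -> differentiable h (a *: s + y)) ->
  exists2 a, 0 <= a <= t & h (t *: s + y) - h y = t * 'D_s h (a *: s + y).
Proof.
move=> t0 dh.
have [a t01|| a] := @MVT_segment R (fun a => h (a *: s + y))
    (fun a => 'D_s h (a *: s + y)) 0 t t0.
- apply: is_derive_line; apply: dh; move: t01; rewrite in_itv /=.
  by move=> /andP[/ltW -> /ltW ->].
- apply: continuous_in_subspaceT => a; rewrite inE /= in_itv /= => /dh dha.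
  have [+ _] := is_derive_line dha.
  by move=> /derivable1_diffP/differentiable_continuous.
rewrite in_itv /= => a0t; rewrite scale0r add0r subr0 mulrC => ->.
by exists a.
Qed.

(* Both mixed derivatives approximate the same second difference over [t ^+ 2]. *)
Lemma schwarz_derive h U x s w : open U -> Ck_on 2 U h -> U x ->
  'D_s ('D_w h) x = 'D_w ('D_s h) x.
Proof.
move=> oU Ch Ux.
pose Delta t := h (t *: s + (t *: w + x)) - h (t *: s + x) -
  (h (t *: w + x) - h x).
(* Two mean value steps: along [s'] for [h (t *: w' + z) - h z], then along [w'] for ['D_s' h]. The
   intermediate point tends to [x], where the iterated derivative is continuous. *)
have key s' w' e : 0 < e -> \forall t \near (0 : R)^'+,
    `|(h (t *: s' + (t *: w' + x)) - h (t *: s' + x) - (h (t *: w' + x) - h x)) -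
      t * (t * 'D_w' ('D_s' h) x)| <= t * (t * e).
  move=> e0; have [dh Dh] := Ch; have [dDh DDh] := Dh s'.
  have cDD : {for x, continuous ('D_w' ('D_s' h))}.
    exact: DDh w' x Ux.
  have : \forall y \near x, U y /\ `|'D_w' ('D_s' h) x - 'D_w' ('D_s' h) y| <= e.
    apply: filterI; first exact: open_nbhs_nbhs.
    by have /cvgrPdist_le/(_ _ e0) := cDD.
  move=> /nbhs_ballP[r /= r0 rP]; near=> t.
  have t0 : 0 < t by near: t; exact: nbhs_right_gt.
  have tr : t * (`|s'| + `|w'|) < r.
    have H : 0 < `|s'| + `|w'| + 1 by rewrite ltr_wpDl // addr_ge0.
    have : t < r / (`|s'| + `|w'| + 1).
      by near: t; apply: nbhs_right_lt; rewrite divr_gt0.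
    by rewrite ltr_pdivlMr // mulrDr mulr1; lra.
  have inb a b : 0 <= a <= t -> 0 <= b <= t -> ball x r (a *: s' + (b *: w' + x)).
    move=> /andP[a0 at_] /andP[b0 bt]; rewrite -ball_normE /=.
    rewrite addrA opprD addrCA subrr addr0 normrN.
    apply: le_lt_trans tr; apply: (le_trans (ler_normD _ _)).
    by rewrite mulrDr !normrZ !ger0_norm // lerD // ler_wpM2r.
  have inb' a b : 0 <= a <= t -> 0 <= b <= t -> U (b *: w' + (a *: s' + x)).
    by move=> a0t b0t; rewrite addrCA; have /rP[] := inb a b a0t b0t.
  have t0t : 0 <= t <= t by rewrite lexx ltW.
  have z0t : 0 <= (0 : R) <= t by rewrite lexx ltW.
  have trl (z v : V) (q : R) : t *: w' + (q *: v + z) = q *: v + (t *: w' + z).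
    by rewrite addrCA.
  have dtr a : 0 <= a <= t -> differentiable (fun z => h (t *: w' + z)) (a *: s' + x).
    move=> a0t; apply: (@differentiable_comp _ _ _ _ (fun z : V => t *: w' + z) h).
      by apply: differentiableD => //; exact: differentiable_cst.
    by apply: dh; exact: inb'.
  have dha a : 0 <= a <= t -> differentiable h (a *: s' + x).
    by move=> a0t; apply: dh; have := inb' a 0 a0t z0t; rewrite scale0r add0r.
  have [|a a0t] := @mvt_line (fun z => h (t *: w' + z) - h z) x s' t (ltW t0).
    by move=> a a0t; apply: differentiableB; [exact: dtr|exact: dha].
  have -> : 'D_s' (fun z => h (t *: w' + z) - h z) (a *: s' + x) =
      'D_s' h (t *: w' + (a *: s' + x)) - 'D_s' h (a *: s' + x).
    rewrite (@deriveB _ _ _ (fun z => h (t *: w' + z)) h).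
    - by rewrite (derive_comp_affine h _ _ trl).
    - by apply: diff_derivable; exact: dtr.
    - by apply: diff_derivable; exact: dha.
  have [|b b0t ->] := @mvt_line ('D_s' h) (a *: s' + x) w' t (ltW t0).
    by move=> b b0t; apply: dDh; exact: inb'.
  rewrite [t *: s' + (t *: w' + x)]addrCA => HE.
  rewrite (HE : h (t *: w' + (t *: s' + x)) - h (t *: s' + x) -
    (h (t *: w' + x) - h x) = _) -!mulrBr !normrM gtr0_norm //.
  by rewrite !ler_wpM2l ?(ltW t0) // distrC addrCA; have /rP[] := inb a b a0t b0t.
have D t : h (t *: w + (t *: s + x)) - h (t *: w + x) - (h (t *: s + x) - h x) = Delta t.
  by rewrite /Delta [t *: w + (t *: s + x)]addrCA; ring.
apply/eqP; rewrite -subr_eq0 -normr_le0; apply/ler_addgt0Pr => e e0.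
have e2 : 0 < e / 2 by rewrite divr_gt0.
have [t [t0 [h1 h2]]] := filter_ex (filterI (nbhs_right_gt (0 : R))
  (filterI (key s w _ e2) (key w s _ e2))).
rewrite D in h2.
by rewrite add0r; exact: two_limits_close t0 h1 h2.
Unshelve. all: by end_near. Qed.

(** Subtracting the candidate quadratic with coefficient [c] leaves a function whose derivative is
    at most [e], by the mean value theorem. As [c] is free, the error measures only the oscillation
    of the second derivative. *)
Lemma taylor2 h U y v (c e : R) : Ck_on 2 U h ->
  (forall a, 0 <= a <= 1 -> U (a *: v + y)) ->
  (forall a, 0 <= a <= 1 -> `|'D_v ('D_v h) (a *: v + y) - c| <= e) ->
  `|h (v + y) - h y - 'D_v h y - 2^-1 * c| <= e.
Proof.
move=> [dh Dh] Uy ce; have [dDh _] := Dh v.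
pose F (a : R) := h (a *: v + y) - a * 'D_v h y - 2^-1 * a ^+ 2 * c.
pose F' (a : R) := 'D_v h (a *: v + y) - 'D_v h y - a * c.
have dF a : 0 <= a <= 1 -> is_derive (a : R^o) (1 : R^o) F (F' a).
  move=> a01; have d1 := is_derive_line (dh _ (Uy a a01)).
  have d2 := is_deriveZ ('D_v h y : R) (is_derive_id (a : R^o) (1 : R^o)).
  have d3 := is_deriveZ (2^-1 * c : R) (is_deriveX 2 (is_derive_id (a : R^o) (1 : R^o))).
  have := is_deriveB (is_deriveB d1 d2) d3.
  set F1 := (X in is_derive _ _ X _ -> _); set D1 := (X in is_derive _ _ _ X -> _).
  have -> : F1 = F.
    apply/funext => b; rewrite /F1 /F !fctE.
    by congr (_ - _ - _); rewrite /= /GRing.scale /=; ring.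
  suff -> : D1 = F' a by [].
  by rewrite /D1 /F' /GRing.scale /= !mulr1 expr1; field.
have F'le a : 0 <= a <= 1 -> `|F' a| <= e.
  move=> /andP[a0 a1].
  have [|b b0a] := @mvt_line ('D_v h) y v a a0.
    by move=> b /andP[b0 ba]; apply: dDh; apply: Uy; rewrite b0 /=; lra.
  rewrite /F' => ->; rewrite -mulrBr normrM ger0_norm //.
  have : `|'D_v ('D_v h) (b *: v + y) - c| <= e.
    by apply: ce; case/andP: b0a => -> ?; lra.
  by move=> H; rewrite -[leRHS]mul1r; apply: ler_pM.
have [a a01|| a] := @MVT_segment R F F' 0 1 ler01.
- by apply: dF; move: a01; rewrite in_itv /= => /andP[/ltW -> /ltW ->].
- apply: continuous_in_subspaceT => a; rewrite inE /= in_itv /= => /dF[+ _].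
  by move=> /derivable1_diffP/differentiable_continuous.
rewrite in_itv /= => /F'le; rewrite subr0 mulr1 => Fa FE.
suff -> : h (v + y) - h y - 'D_v h y - 2^-1 * c = F 1 - F 0 by rewrite FE.
by rewrite /F scale1r scale0r add0r; ring.
Qed.

End SecondOrder.

(** * Pullback by the retraction *)

Definition Ck_from {R : realType} {n : nat} {M : manifold R n} k (g : M -> R) :=
  forall c, atlas M c -> Ck_on k (img c) (g \o cinv c : 'rV[R]_n -> R^o).

Lemma open_preim_on (S T : topologicalType) (U : set S) (D : set T) (h : S -> T) :
  open U -> open D -> (forall x, U x -> {for x, continuous h}) ->
  open (U `&` h @^-1` D).
Proof.
move=> oU oD ch; rewrite openE => x [Ux Dx]; rewrite /interior.
apply: filterI; first exact: open_nbhs_nbhs.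
by apply: near_preim (ch x Ux) _; exact: open_nbhs_nbhs.
Qed.

Section Composition.
Context {R : realType} {n : nat} {M : manifold R n}.

Lemma Ck_from_comp (V : normedModType R) k (U : set V) (h : V -> M) (g : M -> R) :
  open U -> smooth_into U h -> Ck_from k g -> Ck_on k U (g \o h : V -> R^o).
Proof.
move=> oU sh Cg; apply: Ck_on_local => x Ux.
pose d := chart_at (h x); have ad : atlas M d := chart_at_atlas _.
exists (U `&` h @^-1` dom d); first by split=> //; exact: chart_at_dom.
have oUd : open (U `&` h @^-1` dom d).
  by apply: open_preim_on => //; [exact: dom_open|exact: sh.1].
have := @Ck_on_comp _ _ _ k _ _ _ (coord d \o h) oUd (@img_open _ _ _ d) _
  (sh.2 d ad k) (Cg d ad).
move=> H; apply: (Ck_on_eq oUd) (H _) => y [Uy dy] /=; first by rewrite coordK.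
exact: img_coord.
Qed.

Lemma Ck_from_continuous k (g : M -> R) z : Ck_from k g -> {for z, continuous g}.
Proof.
move=> Cg; pose d := chart_at z.
have ad : atlas M d := chart_at_atlas _; have dz : dom d z := chart_at_dom _.
have cg := Ck_on_continuous (Cg d ad) (img_coord dz).
have : {for z, continuous ((g \o cinv d) \o coord d)}.
  by apply: continuous_comp; [exact: coord_cont|exact: cg].
rewrite /prop_for /continuous_at /= coordK // => H.
apply: cvg_trans H; apply: near_eq_cvg.
by apply: filterS (near_dom dz) => y dy /=; rewrite coordK.
Qed.

Lemma Ck_from_smooth_comp (m k : nat) (phi : M -> 'rV[R]_m) (U : set 'rV[R]_m)
    (f : 'rV[R]_m -> R^o) :
  smooth_from phi -> open U -> range phi `<=` U -> Ck_on k U f ->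
  Ck_from k (f \o phi).
Proof.
move=> sphi oU phiU Cf c ac.
apply: (@Ck_on_comp _ _ _ _ _ U f (phi \o cinv c)) => //.
- exact: img_open.
- by move=> x _; apply: phiU; exists (cinv c x).
- exact: sphi.
Qed.

End Composition.

Section Pullback.
Context {R : realType} {n : nat} {M : manifold R n} (G : riemannian_metric M).
Context (Rt : retraction M) (g : M -> R) (Cg : Ck_from 2 g).
Implicit Types (y z : M) (s v w : 'rV[R]_n).
Local Notation VV := ('rV[R]_n * 'rV[R]_n)%type.

(* The pullback [g \o Rt y] read in a chart, with the base point as a second
   variable: joint regularity gives estimates that are uniform near a point. *)
Definition chart_pull (c : chart R n M) (p : VV) : R :=
  g (Rt (cinv c p.1) (tvec c (cinv c p.1) p.2)).
Local Notation K := chart_pull.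

(** Derivatives along such directions vary the tangent vector and keep the base point fixed. *)
Definition zvec v : VV := (0, v).

Lemma chart_pull_open (c : chart R n M) : open (img c `*` setT : set VV).
Proof.
have -> : img c `*` setT = (fst : VV -> 'rV[R]_n) @^-1` img c.
  by apply/seteqP; split=> [x []|x].
by apply: open_comp => [p _|]; [exact: cvg_fst|exact: img_open].
Qed.

Lemma chart_pull_Ck c : atlas M c ->
  Ck_on 2 (img c `*` setT) (K c : VV -> R^o).
Proof.
move=> ac.
exact: (Ck_from_comp (@chart_pull_open c) (ret_smooth Rt ac) Cg).
Qed.

Lemma pair_affine (x : 'rV[R]_n) (v w : 'rV[R]_n) (r : R) :
  (x, r *: w + v) = r *: zvec w + (x, v) :> VV.
Proof.
transitivity ((r *: 0 + x, r *: w + v) : VV); last by [].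
by rewrite scaler0 add0r.
Qed.

Lemma pair_differentiable (x v : 'rV[R]_n) :
  differentiable (fun v : 'rV[R]_n => (x, v) : VV) v.
Proof. by apply: differentiable_pair => //; exact: differentiable_cst. Qed.

Lemma ret_smooth_into y : smooth_into setT (Rt y).
Proof.
pose c := chart_at y; have ac : atlas M c := chart_at_atlas _.
have cy : dom c y := chart_at_dom _.
have := @smooth_into_affine R n M 'rV[R]_n VV _ _ (fun v => (coord c y, v)) zvec
  (fun v w r => pair_affine _ v w r) (pair_differentiable _) (ret_smooth Rt ac).
set h := (_ \o _); have -> : h = Rt y.
  by apply/funext => v; rewrite /h /= coordK // tvec_chart_at.
by apply: smooth_intoS => v _ /=; split=> //; exact: img_coord.
Qed.

Lemma pull_Ck y : Ck_on 2 setT (g \o Rt y : 'rV[R]_n -> R^o).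
Proof. by apply: Ck_from_comp => //; [exact: openT|exact: ret_smooth_into]. Qed.

Lemma pull_diff y v : differentiable (g \o Rt y : 'rV[R]_n -> R^o) v.
Proof. by have [+ _] := pull_Ck y; exact. Qed.

Definition pull_d1 y w : R := 'D_w (g \o Rt y : 'rV[R]_n -> R^o) 0.
Definition pull_d2 y s w : R :=
  'D_s ('D_w (g \o Rt y : 'rV[R]_n -> R^o) : 'rV[R]_n -> R^o) 0.

Lemma D1_linear y (a : R) s w v : pull_d1 y (a *: s + w) = a * pull_d1 y s + pull_d1 y w.
Proof. exact: derive_lin (pull_diff y 0). Qed.

Lemma D2_sb y : sym_bilinear (pull_d2 y).
Proof.
split=> [s w|a s v w].
  exact: (schwarz_derive _ _ openT (pull_Ck y)).
apply: derive_lin; have [_ /(_ w)[+ _]] := pull_Ck y; exact.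
Qed.

Lemma pull_gradP y w : G y (pull_grad G Rt g y) w = pull_d1 y w.
Proof.
have [v vP] := form_riesz (inner_sb G y) (inner_pd G y)
  (fun a s w => @D1_linear y a s w 0).
by apply: (@xgetPex _ 0 [set v | forall w, G y v w = pull_d1 y w]); exists v.
Qed.

Lemma pull_hessP y s w : G y (pull_hess G Rt g y s) w = pull_d2 y s w.
Proof.
have [|v vP] := @form_riesz _ _ _ (inner_sb G y) (inner_pd G y) (pull_d2 y s).
  move=> a u v; rewrite ((D2_sb y).1 s (a *: u + v)) (D2_sb y).2.
  by rewrite ((D2_sb y).1 s u) ((D2_sb y).1 s v).
by apply: (@xgetPex _ 0 [set v | forall w, G y v w = pull_d2 y s w]); exists v.
Qed.

Lemma ret0_derive y w : 'D_w (coord (chart_at y) \o Rt y) 0 = w.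
Proof.
have := ret_velocity Rt y w; rewrite /velocity scale0r ret_zero derive1E => H.
rewrite -[RHS]H.
have al (x v : R^o) (r : R) : (r *: v + x) *: w = r *: (v *: w) + x *: w.
  by rewrite scalerDl scalerA.
have := derive_comp_affine (coord (chart_at y) \o Rt y) (0 : R^o) (1 : R^o) al.
by rewrite scale1r scale0r.
Qed.

(** The differential of a retraction at the origin is the identity ([ret0_derive]), so first
    derivatives are unchanged by the pullback; hence the two gradients agree. *)
Lemma pull_derive_chart y w :
  'D_w (g \o cinv (chart_at y) : 'rV[R]_n -> R^o) (coord (chart_at y) y) = pull_d1 y w.
Proof.
pose d := chart_at y; have ad : atlas M d := chart_at_atlas _.
have dy : dom d y := chart_at_dom _.
have dr : differentiable (coord d \o Rt y) 0.
  by apply: smooth_into_diff (ret_smooth_into y) ad _ _ => //; rewrite ret_zero.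
have dg : differentiable (g \o cinv d : 'rV[R]_n -> R^o) (coord d y).
  by have [+ _] := Cg ad; apply; exact: img_coord.
have := @derive_comp_basis R 'rV[R]_n n R^o (g \o cinv d) (coord d \o Rt y) 0 w dr.
rewrite /= ret_zero ret0_derive => /(_ dg) <-.
apply: near_eq_derive.
have cR : {for 0, continuous (Rt y)} by exact: (ret_smooth_into y).1.
have : \forall v \near (0 : 'rV[R]_n), dom d (Rt y v).
  by apply: (near_preim cR); rewrite ret_zero; exact: near_dom.
by apply: filterS => v dv /=; rewrite coordK.
Qed.

Lemma rgradE y : rgrad G g y = pull_grad G Rt g y.
Proof.
rewrite /rgrad /pull_grad /gradient; congr xget; apply/funext => v.
apply/propext; split=> vP w; first by rewrite vP pull_derive_chart.
by rewrite vP -/(pull_d1 y w) -pull_derive_chart.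
Qed.

Lemma modelE y s : model G Rt g y s = g y + pull_d1 y s + 2^-1 * pull_d2 y s s.
Proof. by rewrite /model !(inner_sym G y s) pull_gradP pull_hessP. Qed.

(** For fixed [y], the chart pullback in its second variable is [g \o Rt y] precomposed with the
    linear map [tvec c y]. Derivatives in jumping tangent coordinates thus become derivatives of a
    single regular function of the pair. *)
Lemma chart_pull_derive c y v w : atlas M c -> dom c y ->
  'D_(tvec c y w) (g \o Rt y : 'rV[R]_n -> R^o) (tvec c y v) =
  'D_(zvec w) (K c : VV -> R^o) (coord c y, v).
Proof.
move=> ac cy.
have al (v' w' : 'rV[R]_n) (r : R) :
    tvec c y (r *: w' + v') = r *: tvec c y w' + tvec c y v'.
  exact: tvec_linear.
rewrite -(derive_comp_affine (g \o Rt y : 'rV[R]_n -> R^o) v w al).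
rewrite -(derive_comp_affine (K c : VV -> R^o) v w
  (fun v w r => pair_affine (coord c y) v w r)).
by congr ('D_w _ v); apply/funext => u; rewrite /K /= coordK.
Qed.

Lemma chart_pull_D1 c y w : atlas M c -> dom c y ->
  pull_d1 y (tvec c y w) = 'D_(zvec w) (K c : VV -> R^o) (coord c y, 0).
Proof. by move=> ac cy; rewrite -chart_pull_derive // tvec0. Qed.

Lemma chart_pull_D2 c y s w : atlas M c -> dom c y ->
  pull_d2 y (tvec c y s) (tvec c y w) =
  'D_(zvec s) ('D_(zvec w) (K c : VV -> R^o) : VV -> R^o) (coord c y, 0).
Proof.
move=> ac cy.
have al (v' w' : 'rV[R]_n) (r : R) :
    tvec c y (r *: w' + v') = r *: tvec c y w' + tvec c y v'.
  exact: tvec_linear.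
rewrite /pull_d2 -{1}(tvec0 ac cy).
rewrite -(derive_comp_affine ('D_(tvec c y w) (g \o Rt y : 'rV[R]_n -> R^o)) 0 s al).
rewrite -(derive_comp_affine ('D_(zvec w) (K c : VV -> R^o)) 0 s
  (fun v w r => pair_affine (coord c y) v w r)).
set f1 := (_ \o tvec c y); set f2 := (_ \o pair (coord c y)).
suff -> : f1 = f2 by [].
apply/funext => u; exact (@chart_pull_derive c y u w ac cy).
Qed.

End Pullback.

(** * Estimates uniform near a point *)

Lemma norm_dist_le (R : realType) (a b e : R) :
  `|a - b| <= e -> `|b| <= `|a| + e.
Proof.
by move=> h; have := ler_normB a (a - b); rewrite subKr; lra.
Qed.

Lemma norm_dist_tri (R : realType) (a b c e : R) :
  `|a - b| <= e -> `|a - c| <= e -> `|b - c| <= 2 * e.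
Proof.
move=> h1 h2; have -> : b - c = (a - c) - (a - b) by ring.
by apply: (le_trans (ler_normB _ _)); lra.
Qed.

Lemma quadratic_le (R : realType) (a c x : R) : 0 < a -> 0 <= c -> 0 <= x ->
  a * (x * x) <= c * x -> x <= c / a + 1.
Proof.
move=> a0 c0; rewrite le_eqVlt => /predU1P[<- _|x0].
  by rewrite addr_ge0 // divr_ge0 // ltW.
rewrite mulrA ler_pM2r // => h.
have : x <= c / a by rewrite ler_pdivlMr // mulrC.
lra.
Qed.

Section NearEstimates.
Context {R : realType} {n : nat} {M : manifold R n} (G : riemannian_metric M).
Context (Rt : retraction M) (g : M -> R) (Cg : Ck_from 2 g).
Implicit Types (y z : M) (s v w : 'rV[R]_n).
Local Notation VV := ('rV[R]_n * 'rV[R]_n)%type.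
Local Notation K c := (chart_pull Rt g c : VV -> R^o).
Local Notation D1 := (pull_d1 Rt g).
Local Notation D2 := (pull_d2 Rt g).
Local Notation grad := (rgrad G g).
Local Notation c_ z := (chart_at z).

Lemma metric_near z : exists a b, [/\ 0 < a, 0 < b &
  \forall y \near z, dom (c_ z) y /\ forall v,
    a * `|v| <= rnorm G y (tvec (c_ z) y v) <= b * `|v|].
Proof.
have ac : atlas M (c_ z) := chart_at_atlas _.
have cz : dom (c_ z) z := chart_at_dom _.
have [a [b [a0 b0 ab]]] := metric_comparable G ac (img_coord cz).
exists a, b; split=> //; apply: filterS2 (near_dom cz) (near_coord cz ab).
by move=> y cy; rewrite (coordK cy) => -[_ aby]; split.
Qed.

(** Taken at every pair and not only at zero vectors, because the Taylor expansion involves the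
    whole segment from the base point to the step. *)
Definition hess_coef z (i j : 'I_n) (p : VV) : R :=
  'D_(zvec 'e_i) ('D_(zvec 'e_j) (K (c_ z)) : VV -> R^o) p.

Lemma zvec_lin (a : R) u v : zvec (a *: u + v) = a *: zvec u + zvec v :> VV.
Proof.
transitivity ((a *: 0 + 0, a *: u + v) : VV); last by [].
by rewrite scaler0 addr0.
Qed.

Lemma chart_hess_sb z p : img (c_ z) p.1 -> sym_bilinear (fun s w =>
  'D_(zvec s) ('D_(zvec w) (K (c_ z)) : VV -> R^o) p).
Proof.
move=> zp; have CK := chart_pull_Ck Rt Cg (chart_at_atlas z).
have Up : (img (c_ z) `*` setT) p by split.
split=> [s w|a s v w].
  exact: (schwarz_derive _ _ (@chart_pull_open _ _ _ (c_ z)) CK Up).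
rewrite zvec_lin; apply: derive_lin.
by have [_ /(_ (zvec w))[+ _]] := CK; exact.
Qed.

Lemma chart_hessE z p s w : img (c_ z) p.1 ->
  'D_(zvec s) ('D_(zvec w) (K (c_ z)) : VV -> R^o) p =
  mx_form (hess_coef z) p s w.
Proof. by move=> zp; rewrite (form_expand (chart_hess_sb zp)). Qed.

Lemma D2E z y s w : dom (c_ z) y ->
  D2 y (tvec (c_ z) y s) (tvec (c_ z) y w) =
  mx_form (hess_coef z) (coord (c_ z) y, 0) s w.
Proof.
move=> zy; rewrite (chart_pull_D2 _ _ s w (chart_at_atlas z) zy).
by rewrite chart_hessE //; exact: img_coord.
Qed.

Lemma hess_coef_continuous z i j p : img (c_ z) p.1 ->
  {for p, continuous (hess_coef z i j)}.
Proof.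
move=> zp; have [_ /(_ (zvec 'e_j))[_ /(_ (zvec 'e_i))]] :=
  chart_pull_Ck Rt Cg (chart_at_atlas z).
by apply; split.
Qed.

Lemma pair0_continuous (x : 'rV[R]_n) :
  {for x, continuous (fun x : 'rV[R]_n => (x, 0) : VV)}.
Proof.
by apply: differentiable_continuous; apply: differentiable_pair.
Qed.

(** The model is the second-order Taylor polynomial of the pullback, so the error is governed by the
    oscillation of [hess_coef] near the zero vector at [z]; joint continuity makes it small for all
    nearby [y] at once. *)
Lemma model_error z (eps : R) : 0 < eps -> exists2 r, 0 < r &
  \forall y \near z, forall s, rnorm G y s <= r ->
    `|g (Rt y s) - model G Rt g y s| <= eps * rnorm G y s ^+ 2.
Proof.
move=> eps0; have ac : atlas M (c_ z) := chart_at_atlas z.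
have cz : dom (c_ z) z := chart_at_dom _.
have [a [b [a0 b0 ab]]] := metric_near z.
pose x0 := coord (c_ z) z; pose p0 : VV := (x0, 0).
have nn0 : 0 < n%:R * n%:R + 1 :> R by rewrite ltr_wpDl // mulr_ge0.
(* Entries within [2 * eta] of each other change the form by at most [n ^ 2 * 2 * eta * |v| ^ 2],
   which is below [eps * (a * |v|) ^ 2]. *)
pose eta := eps * a ^+ 2 / (2 * (n%:R * n%:R + 1)).
have eta0 : 0 < eta by rewrite divr_gt0 // mulr_gt0 // exprn_gt0.
have np : \forall p \near p0, (img (c_ z) `*` setT) p.
  apply: open_nbhs_nbhs; split; first exact: chart_pull_open.
  by split=> //; exact: img_coord.
have nc : \forall p \near p0,
    forall i j, `|hess_coef z i j p0 - hess_coef z i j p| <= eta.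
  have H i j : \forall p \near p0, `|hess_coef z i j p0 - hess_coef z i j p| <= eta.
    have := @hess_coef_continuous z i j p0 (img_coord cz).
    by move=> /cvgrPdist_le/(_ _ eta0).
  have H1 i : \forall p \near p0,
      forall j, `|hess_coef z i j p0 - hess_coef z i j p| <= eta.
    exact: filter_forall (H i).
  exact: filter_forall H1.
have /nbhs_ballP[e /= e0 eP] : \forall p \near p0, (img (c_ z) `*` setT) p /\
    forall i j, `|hess_coef z i j p0 - hess_coef z i j p| <= eta.
  exact: (filterI np nc).
exists (a * e / 2); first by rewrite divr_gt0 // mulr_gt0.
have nx : \forall y \near z, ball x0 e (coord (c_ z) y).
  by apply: near_coord cz _; exact: nbhsx_ballx.
apply: filterS2 ab nx => y [cy aby] xy s sr.
have [v vE] := tvec_surj s ac cy.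
pose x := coord (c_ z) y.
have va : a * `|v| <= rnorm G y s by rewrite -vE; have /andP[] := aby v.
have ve : `|v| < e.
  have : a * `|v| <= a * (e / 2) by rewrite mulrA; exact: le_trans va sr.
  by rewrite ler_pM2l //; lra.
have bp t : 0 <= t <= 1 -> ball p0 e (x, t *: v).
  move=> /andP[t0 t1]; split=> //=; rewrite -ball_normE /= sub0r normrN normrZ.
  by rewrite ger0_norm //; apply: le_lt_trans ve; rewrite ler_piMl.
have pE t : t *: zvec v + (x, 0) = (x, t *: v) :> VV.
  by rewrite -(pair_affine x 0) addr0.
have p1 : 0 <= (0 : R) <= 1 by rewrite lexx ler01.
have c0 : forall i j, `|hess_coef z i j p0 - hess_coef z i j (x, 0)| <= eta.
  by have [_] := eP _ (bp 0 p1); rewrite scale0r.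
have := @taylor2 R VV (K (c_ z)) (img (c_ z) `*` setT) (x, 0) (zvec v)
  (D2 y s s) (n%:R * n%:R * (2 * eta) * `|v| ^+ 2).
move=> /(_ (chart_pull_Ck Rt Cg ac)) H.
have {H} : `|K (c_ z) (zvec v + (x, 0)) - K (c_ z) (x, 0) -
    'D_(zvec v) (K (c_ z)) (x, 0) - 2^-1 * D2 y s s| <=
    n%:R * n%:R * (2 * eta) * `|v| ^+ 2.
  apply: H => [t t01|t t01]; rewrite pE; first by have [] := eP _ (bp t t01).
  have [[xi _] ct] := eP _ (bp t t01).
  rewrite -vE D2E // chart_hessE // -/x.
  have -> : mx_form (hess_coef z) (x, t *: v) v v - mx_form (hess_coef z) (x, 0) v v =
      mx_form (fun i j p => hess_coef z i j p - hess_coef z i j (x, 0)) (x, t *: v) v v.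
    rewrite /mx_form -sumrB; apply: eq_bigr => i _; rewrite -sumrB.
    by apply: eq_bigr => j _; rewrite mulrBr.
  apply: mx_form_le => i j.
  exact: norm_dist_tri (ct i j) (c0 i j).
have <- : D1 y s = 'D_(zvec v) (K (c_ z)) (x, 0).
  by rewrite -vE chart_pull_D1.
have -> : K (c_ z) (zvec v + (x, 0)) = g (Rt y s).
  have := pE 1; rewrite !scale1r => ->.
  by rewrite /chart_pull /= coordK // vE.
have -> : K (c_ z) (x, 0) = g y.
  by rewrite /chart_pull /= coordK // tvec0 // ret_zero.
rewrite (modelE G Rt Cg) => H.
have -> : g (Rt y s) - (g y + D1 y s + 2^-1 * D2 y s s) =
  g (Rt y s) - g y - D1 y s - 2^-1 * D2 y s s by ring.
apply: (le_trans H).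
apply: (@le_trans _ _ (eps * (a * `|v|) ^+ 2)); last first.
  by rewrite ler_pM2l // lerXn2r // nnegrE ?sqrtr_ge0 // mulr_ge0 // ltW.
rewrite exprMn [leRHS]mulrA; apply: ler_wpM2r; first exact: sqr_ge0.
rewrite /eta -[leRHS]mul1r.
rewrite [leLHS](_ : _ = (n%:R * n%:R / (n%:R * n%:R + 1)) * (eps * a ^+ 2)).
  apply: ler_wpM2r; first by rewrite mulr_ge0 ?sqr_ge0 // ltW.
  by rewrite ler_pdivrMr ?mul1r ?lerDl.
by field; rewrite gt_eqF.
Qed.

Lemma hess_bound z : exists2 beta, 0 < beta &
  \forall y \near z, forall s, `|D2 y s s| <= beta * rnorm G y s ^+ 2.
Proof.
have cz : dom (c_ z) z := chart_at_dom _.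
have [a [b [a0 b0 ab]]] := metric_near z.
have cc i j : {for coord (c_ z) z, continuous (fun x => hess_coef z i j (x, 0))}.
  apply: (@continuous_comp _ _ _ (fun x : 'rV[R]_n => (x, 0) : VV)).
    exact: pair0_continuous.
  exact: (@hess_coef_continuous z i j (_, 0) (img_coord cz)).
have [B B0 BP] := near_form_upper cc.
exists (B / a ^+ 2); first by rewrite divr_gt0 // exprn_gt0.
apply: filterS2 ab (near_coord cz BP) => y [cy aby] By s.
have [v vE] := tvec_surj s (chart_at_atlas z) cy.
have va : a * `|v| <= rnorm G y s by rewrite -vE; have /andP[] := aby v.
rewrite -{1 2}vE D2E //; apply: (le_trans (By v)).
rewrite mulrAC ler_pdivlMr ?exprn_gt0 // -mulrA ler_pM2l // mulrC -exprMn.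
by rewrite lerXn2r // nnegrE ?sqrtr_ge0 // mulr_ge0 // ltW.
Qed.

Lemma grad_D1 y w : G y (grad y) w = D1 y w.
Proof. by rewrite (rgradE G Rt Cg) (pull_gradP G Rt Cg). Qed.

Lemma chart_D1_continuous z w :
  {for coord (c_ z) z, continuous (fun x => 'D_(zvec w) (K (c_ z)) (x, 0))}.
Proof.
have [_ /(_ (zvec w))[dK _]] := chart_pull_Ck Rt Cg (chart_at_atlas z).
apply: (@continuous_comp _ _ _ (fun x : 'rV[R]_n => (x, 0) : VV)
  ('D_(zvec w) (K (c_ z)))); first exact: pair0_continuous.
apply: differentiable_continuous; apply: dK; split=> //.
by apply: img_coord; exact: chart_at_dom.
Qed.

(** The squared norm [N ^ 2] equals [D1 y (grad y)], which is at most [C * |v|] for the chart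
    components [v] of the gradient, while [a * |v| <= N]; hence [a * N ^ 2 <= C * N]. *)
Lemma grad_upper z : exists2 e, 0 < e &
  \forall y \near z, rnorm G y (grad y) <= e.
Proof.
have cz : dom (c_ z) z := chart_at_dom _.
have [a [b [a0 b0 ab]]] := metric_near z.
pose d i x := 'D_(zvec 'e_i) (K (c_ z)) (x, 0).
pose C := \sum_i (`|d i (coord (c_ z) z)| + 1).
have C0 : 0 <= C by apply: sumr_ge0 => i _; rewrite addr_ge0.
have nd : \forall y \near z, forall i,
    `|d i (coord (c_ z) y)| <= `|d i (coord (c_ z) z)| + 1.
  apply: filter_forall => i.
  suff H : \forall x \near coord (c_ z) z, `|d i x| <= `|d i (coord (c_ z) z)| + 1.
    exact: near_coord cz H.
  have /cvgrPdist_le/(_ _ ltr01) := @chart_D1_continuous z 'e_i.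
  by apply: filterS => x; exact: norm_dist_le.
exists (C / a + 1); first by rewrite ltr_wpDl // divr_ge0 // ltW.
apply: filterS2 ab nd => y [cy aby] dy.
have [v vE] := tvec_surj (grad y) (chart_at_atlas z) cy.
set N := rnorm G y (grad y).
have N0 : 0 <= N by exact: sqrtr_ge0.
have va : a * `|v| <= N by rewrite /N -vE; have /andP[] := aby v.
have NE : N ^+ 2 = D1 y (grad y).
  by rewrite -grad_D1; exact: (fnorm_sqr (inner_sb G y) (inner_pd G y)).
have D1C : `|D1 y (grad y)| <= C * `|v|.
  rewrite -vE (chart_pull_D1 _ _ _ (chart_at_atlas z) cy).
  have -> : 'D_(zvec v) (K (c_ z)) (coord (c_ z) y, 0) =
      \sum_i v 0 i * d i (coord (c_ z) y).
    have dK : differentiable (K (c_ z)) (coord (c_ z) y, 0).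
      have [+ _] := chart_pull_Ck Rt Cg (chart_at_atlas z); apply.
      by split=> //; exact: img_coord.
    rewrite {1}(row_sum_delta v).
    have zsum : zvec (\sum_j v 0 j *: 'e_j) = \sum_j v 0 j *: zvec 'e_j :> VV.
      elim/big_rec2: _ => // i u u' _ <-; exact: zvec_lin.
    rewrite zsum deriveE // linear_sum; apply: eq_bigr => i _.
    by rewrite linearZ /d deriveE.
  apply: (le_trans (ler_norm_sum _ _ _)); rewrite mulr_suml; apply: ler_sum => i _.
  by rewrite normrM mulrC; apply: ler_pM => //; exact: mx_coord_le.
have : a * (N * N) <= C * N.
  rewrite -expr2 NE; apply: (@le_trans _ _ (a * (C * `|v|))).
    by rewrite ler_pM2l //; apply: le_trans (ler_norm _) D1C.
  by rewrite mulrCA ler_wpM2l.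
exact: quadratic_le.
Qed.

(** On the vector with fixed chart components [w], the differential is continuous in [y] and
    positive at [z]; Cauchy-Schwarz converts this into a bound on the gradient. *)
Lemma grad_lower z : grad z != 0 -> exists2 e, 0 < e &
  \forall y \near z, e <= rnorm G y (grad y).
Proof.
move=> gz; have cz : dom (c_ z) z := chart_at_dom _.
have [a [b [a0 b0 ab]]] := metric_near z.
pose w := grad z; pose d x := 'D_(zvec w) (K (c_ z)) (x, 0).
have dz : 0 < d (coord (c_ z) z).
  rewrite /d -chart_pull_D1 //; last exact: chart_at_atlas.
  by rewrite tvec_chart_at -grad_D1; exact: inner_pos.
have w0 : 0 < `|w| by rewrite normr_gt0.
exists (d (coord (c_ z) z) / 2 / (b * `|w|)).
  by rewrite !divr_gt0 // mulr_gt0.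
have nd : \forall y \near z, d (coord (c_ z) z) / 2 <= d (coord (c_ z) y).
  suff H : \forall x \near coord (c_ z) z, d (coord (c_ z) z) / 2 <= d x.
    exact: near_coord cz H.
  apply: (cvgr_ge _ (@chart_D1_continuous z w)).
  by rewrite ltr_pdivrMr // ltr_pMr // ltr1n.
apply: filterS2 ab nd => y [cy aby] dy.
rewrite ler_pdivrMr ?mulr_gt0 //; apply: (le_trans dy).
rewrite /d -chart_pull_D1 //; last exact: chart_at_atlas.
rewrite -grad_D1; apply: (le_trans (ler_norm _)).
apply: (le_trans (fnorm_CS (inner_sb G y) (inner_pd G y) _ _)).
by rewrite ler_wpM2l ?sqrtr_ge0 //; have /andP[] := aby w.
Qed.

Lemma lambda_le y s : s != 0 ->
  lambda_min G Rt g y * rnorm G y s ^+ 2 <= D2 y s s.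
Proof.
move=> s0; have E u v : G y (pull_hess G Rt g y u) v = D2 y u v.
  exact: pull_hessP.
rewrite (fnorm_sqr (inner_sb G y) (inner_pd G y)) -E.
apply: (least_eigenval_le (inner_sb G y) (inner_pd G y)) => //.
have -> : (fun u v => G y (pull_hess G Rt g y u) v) = D2 y.
  by apply/funext => u; apply/funext => v; exact: E.
exact: D2_sb.
Qed.

(** The least eigenvalue is at most the Rayleigh quotient of the vector with fixed components [s],
    whose numerator is continuous in [y] and whose denominator is at most [(b * |s|) ^ 2]. *)
Lemma lambda_upper z s : D2 z s s < 0 -> exists2 l, 0 < l &
  \forall y \near z, lambda_min G Rt g y <= - l.
Proof.
move=> Ds; have cz : dom (c_ z) z := chart_at_dom _.
have [a [b [a0 b0 ab]]] := metric_near z.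
pose d x := mx_form (hess_coef z) (x, 0) s s.
have dE y : dom (c_ z) y -> d (coord (c_ z) y) =
    D2 y (tvec (c_ z) y s) (tvec (c_ z) y s) by move=> cy; rewrite D2E.
have dz : d (coord (c_ z) z) < 0 by rewrite (dE z cz) tvec_chart_at; exact: Ds.
have s0 : s != 0.
  by apply/eqP => s0; move: Ds; rewrite s0 (sbf0l (D2_sb Rt Cg z)) ltxx.
have ns0 : 0 < `|s| by rewrite normr_gt0.
pose l := - d (coord (c_ z) z) / 2.
have l0 : 0 < l by rewrite /l; lra.
exists (l / (b * `|s|) ^+ 2); first by rewrite divr_gt0 // exprn_gt0 // mulr_gt0.
have cd : {for coord (c_ z) z, continuous d}.
  apply: (@continuous_comp _ _ _ (fun x : 'rV[R]_n => (x, 0) : VV)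
    (fun p => mx_form (hess_coef z) p s s)); first exact: pair0_continuous.
  apply: continuous_form => [i j||]; [|exact: cst_continuous..].
  exact: (@hess_coef_continuous z i j (_, 0) (img_coord cz)).
have nd : \forall y \near z, d (coord (c_ z) y) <= - l.
  suff H : \forall x \near coord (c_ z) z, d x <= - l by exact: near_coord cz H.
  by apply: (cvgr_le _ cd); rewrite /l; lra.
apply: filterS2 ab nd => y [cy aby]; rewrite dE // => dy.
pose w := tvec (c_ z) y s.
have w0 : w != 0 by apply: contra_neq s0 => /(tvec_inj0 (chart_at_atlas z) cy).
have N0 : 0 < rnorm G y w.
  by rewrite lt_def sqrtr_ge0 andbT; rewrite (fnorm_eq0 (inner_sb G y) (inner_pd G y)).
have /andP[_ Nb] := aby s.
have := le_trans (lambda_le y w0) dy.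
rewrite -ler_pdivlMr ?exprn_gt0 // => h; apply: (le_trans h).
rewrite mulNr lerN2; apply: ler_wpM2l; first exact: ltW.
rewrite lef_pV2 ?posrE ?exprn_gt0 ?mulr_gt0 //.
by rewrite lerXn2r // nnegrE ?mulr_ge0 ?sqrtr_ge0 // ltW.
Qed.

End NearEstimates.

(** * Second-order criticality *)

Section TwoCritical.
Context {R : realType} {n : nat} {M : manifold R n} (G : riemannian_metric M).
Context (Rt : retraction M) (g : M -> R) (Cg : Ck_from 2 g).

(* At a point where [g] has zero differential, the second derivative of [g]
   along a curve depends on the velocity of the curve only. *)
Lemma curve_second_derivative (c : R -> M) (d : chart R n M) :
  @smooth_into R n M R^o setT c -> atlas M d -> dom d (c 0) ->
  (forall w, 'D_w (g \o cinv d : 'rV[R]_n -> R^o) (coord d (c 0)) = 0) ->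
  let s := derive1 (coord d \o c) 0 in
  derive1 (g \o c) 0 = 0 /\ derive1n 2 (g \o c) 0 =
  \sum_i s 0 i * 'D_s ('D_('e_i) (g \o cinv d : 'rV[R]_n -> R^o)
    : 'rV[R]_n -> R^o) (coord d (c 0)).
Proof.
move=> sc ad d0 Dh0 s.
pose h : 'rV[R]_n -> R^o := g \o cinv d; pose x : R^o -> 'rV[R]_n := coord d \o c.
pose W : set R^o := setT `&` c @^-1` dom d.
have oW : open W.
  by apply: open_preim_on; [exact: openT|exact: dom_open|exact: sc.1].
have W0 : W 0 by split.
have Cx : Ck_on 2 W x := sc.2 d ad 2%N.
have Ch : Ck_on 2 (img d) h := Cg ad.
have xW t : W t -> img d (x t) by move=> [_ dt]; exact: img_coord.
have dx t : W t -> differentiable x t by have [+ _] := Cx; exact.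
have dh t : W t -> differentiable h (x t).
  by move=> Wt; have [+ _] := Ch; apply; exact: xW.
pose H i : 'rV[R]_n -> R^o := 'D_('e_i) h.
pose S (t : R^o) : R^o := \sum_i 'D_1 x t 0 i * H i (x t).
have gcS t : W t -> derive1 (g \o c) t = S t.
  move=> Wt; rewrite derive1E.
  transitivity ('D_1 (h \o x) t).
    apply: near_eq_derive.
    apply: filterS (open_nbhs_nbhs (conj oW Wt)) => u [_ du].
    by rewrite /h /x /= coordK.
  rewrite derive_comp_basis; [|exact: dx|exact: dh].
  by rewrite diff_sum_basis //; exact: dh.
have x0E : x 0 = coord d (c 0) by [].
have H0 i : H i (x 0) = 0 by exact: Dh0.
split.
  by rewrite gcS // /S big1 // => i _; rewrite H0 mulr0.
have sE : s = 'D_1 x 0 by rewrite /s derive1E.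
transitivity (derive1 S (0 : R^o)).
  rewrite derive1nS derive1n1 !derive1E; apply: near_eq_derive.
  by apply: filterS (open_nbhs_nbhs (conj oW W0)) => u; exact: gcS.
have [_ /(_ 1)[dDx _]] := Cx.
have dxi i : is_derive (0 : R^o) (1 : R^o) (fun t => 'D_1 x t 0 i : R^o)
    ('D_1 ('D_1 x) (0 : R^o) 0 i).
  split; last by rewrite derive_coord //; exact: dDx.
  have dD : derivable ('D_1 x) (0 : R^o) 1 by apply: diff_derivable; exact: dDx.
  exact: ((@derivable_mxP _ R^o _ _ _ _ _).1 dD 0 i).
have dHi i : is_derive (0 : R^o) (1 : R^o) (H i \o x) ('D_s (H i) (x 0)).
  have dH : differentiable (H i) (x 0).
    by have [_ /(_ 'e_i)[+ _]] := Ch; apply; exact: xW.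
  have dx0 := dx 0 W0.
  split; first by apply: diff_derivable; exact: differentiable_comp.
  by rewrite sE; exact: (derive_comp_basis (1 : R^o) dx0 dH).
have dS := is_derive_sum (fun i => is_deriveM (dxi i) (dHi i)).
rewrite derive1E (_ : S = \sum_i (fun t : R^o => 'D_1 x t 0 i : R) *
    (H i \o x : R^o -> R)); last first.
  by apply/funext => t; rewrite fct_sumE.
rewrite (@derive_val _ _ _ _ _ _ _ dS); apply: eq_bigr => i _.
by rewrite /= H0 scale0r addr0 -sE.
Qed.

(** With zero differential, any curve may be replaced by the retraction curve [c2] of the same
    velocity, along which the second derivative of [g] is the Hessian of the pullback. *)
Lemma two_critical_hess (z : M) : rgrad G g z = 0 ->
  (forall s, 0 <= pull_d2 Rt g z s s) -> two_critical g z.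
Proof.
move=> gz D2z c sc c0.
pose d := chart_at z; have ad : atlas M d := chart_at_atlas _.
have dz : dom d z := chart_at_dom _.
have Dh0 w : 'D_w (g \o cinv d : 'rV[R]_n -> R^o) (coord d z) = 0.
  by rewrite (pull_derive_chart Rt Cg) -(grad_D1 G Rt Cg) gz (sbf0l (inner_sb G z)).
have dc0 : dom d (c 0) by rewrite c0.
have [|g1 g2] := curve_second_derivative sc ad dc0.
  by rewrite c0; exact: Dh0.
split=> //; rewrite g2; set s := derive1 (coord d \o c) 0.
pose c2 (t : R^o) := Rt z (t *: s).
have al (t v : R^o) (r : R) : (r *: v + t) *: s = r *: (v *: s) + t *: s.
  by rewrite scalerDl scalerA.
have dl (t : R^o) : differentiable (fun t : R^o => t *: s) t by [].
have sc2 : @smooth_into R n M R^o setT c2.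
  exact: (smooth_into_affine al dl (ret_smooth_into Rt z)).
have c20 : c2 0 = z by rewrite /c2 scale0r ret_zero.
have dc20 : dom d (c2 0) by rewrite c20.
have [|_] := curve_second_derivative sc2 ad dc20.
  by rewrite c20; exact: Dh0.
have -> : derive1 (coord d \o c2) 0 = s.
  rewrite derive1E (derive_comp_affine (coord d \o Rt z) (0 : R^o) (1 : R^o) al).
  by rewrite scale1r scale0r ret0_derive.
rewrite c20 c0 => <-.
have -> : derive1n 2 (g \o c2) 0 = pull_d2 Rt g z s s; last exact: D2z.
rewrite derive1nS derive1n1.
have -> : derive1 (g \o c2) =
    ('D_s (g \o Rt z : 'rV[R]_n -> R^o)) \o (fun t : R^o => t *: s).
  apply/funext => t; rewrite derive1E.
  rewrite (derive_comp_affine (g \o Rt z : 'rV[R]_n -> R^o) (t : R^o) (1 : R^o) al).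
  by rewrite scale1r.
rewrite derive1E.
rewrite (derive_comp_affine ('D_s (g \o Rt z : 'rV[R]_n -> R^o)) (0 : R^o) (1 : R^o) al).
by rewrite scale1r scale0r.
Qed.

End TwoCritical.

(** * Trust-region steps *)

Section TrustRegionStep.
Context {R : realType} {n : nat} {M : manifold R n} (G : riemannian_metric M).
Context (Rt : retraction M) (g : M -> R) (Cg : Ck_from 2 g).
Implicit Types (y z : M) (s u v w : 'rV[R]_n) (gam : R).
Local Notation D1 := (pull_d1 Rt g).
Local Notation D2 := (pull_d2 Rt g).
Local Notation grad := (rgrad G g).
Local Notation lam := (lambda_min G Rt g).
Local Notation lneg := (lambda_neg G Rt g).
Local Notation model := (model G Rt g).

Definition eigen_regime y : bool :=
  (lam y < 0) && (rnorm G y (grad y) ^+ 2 < `|lneg y| ^+ 3).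

Lemma model0 y : model y 0 = g y.
Proof.
have D10 : D1 y 0 = 0 by exact: derive0.
by rewrite (modelE G Rt Cg) D10 (sbf0l (D2_sb Rt Cg y)) mulr0 !addr0.
Qed.

Lemma model_line y t u :
  model y (t *: u) = g y + t * G y u (grad y) + 2^-1 * t ^+ 2 * D2 y u u.
Proof.
rewrite (modelE G Rt Cg) -(grad_D1 G Rt Cg) (sbfZr (inner_sb G y)).
rewrite (inner_sym G y (grad y)) (sbfZl (D2_sb Rt Cg y)) (sbfZr (D2_sb Rt Cg y)).
by ring.
Qed.

Lemma rnormZ y t u : rnorm G y (t *: u) = `|t| * rnorm G y u.
Proof. exact: (fnormZ (inner_sb G y)). Qed.

Lemma rnorm_sqr y u : rnorm G y u ^+ 2 = G y u u.
Proof. exact: (fnorm_sqr (inner_sb G y) (inner_pd G y)). Qed.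

Lemma lnegE y : lam y < 0 -> `|lneg y| = - lam y.
Proof. by move=> l0; rewrite /lambda_neg min_l ?ltW // ltr0_norm. Qed.

Lemma eigen_step_decrease y gam s beta : 0 < gam ->
  (forall s, `|D2 y s s| <= beta * rnorm G y s ^+ 2) ->
  eigen_regime y -> admissible_step G Rt g y gam s ->
  [/\ 0 < `|lneg y|, `|lneg y| <= beta, rnorm G y s <= gam * `|lneg y| &
    2^-1 * gam ^+ 2 * `|lneg y| ^+ 3 <= model y 0 - model y s].
Proof.
move=> gam0 D2b er [delta [u [sc [rd cs sdelta msc]]]].
have /andP[l0 _] := er.
move: rd; rewrite /radius_direction -/(eigen_regime y) er => -[dE u1 Hu gu].
have L0 : 0 < `|lneg y| by rewrite lnegE // oppr_gt0.
have D2u : D2 y u u = lam y.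
  rewrite -(pull_hessP G Rt Cg) Hu (sbfZl (inner_sb G y)) -rnorm_sqr u1.
  by rewrite expr1n mulr1.
split=> //.
- have := D2b u; rewrite D2u u1 expr1n mulr1; apply: le_trans.
  by rewrite lnegE // ltr0_norm.
- by rewrite -dE.
have [t [t0 tdelta tmin scE]] := cs.
have d0 : 0 <= delta by rewrite dE mulr_ge0 // ltW.
(* The Cauchy point does at least as well as [t = delta], where the linear term is nonpositive by
   the sign of [u] and the quadratic term is [2^-1 * delta ^ 2 * lam y]. *)
have := tmin delta d0; rewrite rnormZ u1 mulr1 ger0_norm // lexx => /(_ isT).
rewrite -scE model_line D2u => h.
have dgu : delta * G y u (grad y) <= 0 by rewrite mulr_ge0_le0.
have lamE : lam y = - `|lneg y| by rewrite lnegE // opprK.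
rewrite model0; set L := `|lneg y| in lamE dE *.
have key : 2^-1 * delta ^+ 2 * lam y = - (2^-1 * gam ^+ 2 * L ^+ 3).
  by rewrite dE lamE; ring.
rewrite key in h; move: h msc dgu.
move: (g y) (model y sc) (model y s) (delta * _) (2^-1 * _ * _) => x1 x2 x3 x4 x5.
lra.
Qed.

Lemma grad_step_decrease y gam s beta : 0 < gam -> 0 < beta ->
  (forall s, `|D2 y s s| <= beta * rnorm G y s ^+ 2) ->
  ~~ eigen_regime y -> admissible_step G Rt g y gam s ->
  rnorm G y s <= gam * rnorm G y (grad y) /\
  2^-1 * Num.min gam beta^-1 * rnorm G y (grad y) ^+ 2 <= model y 0 - model y s.
Proof.
move=> gam0 beta0 D2b er [delta [u [sc [rd cs sdelta msc]]]].
move: rd; rewrite /radius_direction -/(eigen_regime y) (negbTE er) => -[dE uE].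
split; first by rewrite -dE.
have [t [t0 tdelta tmin scE]] := cs.
(* [tau <= gam] makes [tau *: u] feasible, and [tau * beta <= 1] makes the quadratic term cost at
   most half of the linear gain [tau * E ^ 2]. *)
set E := rnorm G y (grad y) in dE *; pose tau := Num.min gam beta^-1.
have E0 : 0 <= E by exact: sqrtr_ge0.
have tau0 : 0 < tau by rewrite /tau lt_min gam0 invr_gt0.
have nu : rnorm G y u = E by rewrite uE; exact: (fnormN (inner_sb G y)).
have := tmin tau (ltW tau0); rewrite rnormZ nu dE gtr0_norm //.
rewrite ler_wpM2r //; last by rewrite /tau ge_min lexx.
move=> /(_ isT); rewrite -scE model_line uE (sbfNl (inner_sb G y)) -rnorm_sqr.
rewrite (sbfNl (D2_sb Rt Cg y)) (sbfNr (D2_sb Rt Cg y)) opprK -/E => h.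
have D2g : D2 y (grad y) (grad y) <= beta * E ^+ 2.
  exact: le_trans (ler_norm _) (D2b _).
have taub : tau * beta <= 1.
  by rewrite -ler_pdivlMr // div1r /tau ge_min lexx orbT.
rewrite model0 -/tau.
have : 2^-1 * tau ^+ 2 * D2 y (grad y) (grad y) <= 2^-1 * tau * E ^+ 2.
  apply: (@le_trans _ _ (2^-1 * tau ^+ 2 * (beta * E ^+ 2))).
    by rewrite ler_pM2l // mulr_gt0 // exprn_gt0.
  have -> : 2^-1 * tau ^+ 2 * (beta * E ^+ 2) = 2^-1 * tau * E ^+ 2 * (tau * beta).
    by ring.
  by rewrite ler_piMr // !mulr_ge0 ?sqr_ge0 // ltW.
move: h msc.
move: (g y) (model y sc) (model y s) (D2 _ _ _) => x1 x2 x3 x4.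
have -> : tau * - E ^+ 2 = - (tau * E ^+ 2) by ring.
move: (2^-1 * tau ^+ 2 * x4) => x5.
have -> : 2^-1 * tau * E ^+ 2 = tau * E ^+ 2 / 2 by ring.
move: (tau * _) => x6; lra.
Qed.

Lemma accepted_step eta y s err : 0 < eta < 1 ->
  0 < model y 0 - model y s -> `|g (Rt y s) - model y s| <= err ->
  err <= (1 - eta) * (model y 0 - model y s) -> eta <= rho G Rt g y s.
Proof.
move=> /andP[eta0 eta1] dec herr errle.
rewrite /rho gt_eqF // ler_pdivlMr //.
move: herr errle => /ler_normlP[_]; rewrite model0.
by move: (g y) (g (Rt y s)) (model y s) => a b c {dec}; lra.
Qed.

Lemma rho_decrease eta y s : 0 < model y 0 - model y s ->
  eta <= rho G Rt g y s ->
  g (Rt y s) <= g y - eta * (model y 0 - model y s).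
Proof.
move=> dec; rewrite /rho gt_eqF // ler_pdivlMr //.
by move: (g y) (g (Rt y s)) (eta * _) => a b c {dec}; lra.
Qed.

(** The delicate case is a zero denominator, where [rho] is 1 by convention and the step is
    accepted. Absence of model decrease excludes the eigenvector regime and forces a zero gradient,
    hence radius 0 and [s = 0]. *)
Lemma accepted_nonincreasing eta y gam s : 0 < eta -> 0 < gam ->
  admissible_step G Rt g y gam s -> eta <= rho G Rt g y s ->
  g (Rt y s) <= g y.
Proof.
move=> eta0 gam0 adm hrho.
have [beta beta0 /nbhs_singleton D2b] := hess_bound G Rt Cg y.
have [dec0|] := ltrP 0 (model y 0 - model y s).
  apply: (le_trans (rho_decrease dec0 hrho)).
  by rewrite gerBl mulr_ge0 // ltW.
have [er|er] := boolP (eigen_regime y).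
  have [L0 _ _ h] := eigen_step_decrease gam0 D2b er adm.
  move=> /(le_trans h); rewrite leNgt => /negP[].
  by rewrite mulr_gt0 ?exprn_gt0 // mulr_gt0 // exprn_gt0.
have [ns h] := grad_step_decrease gam0 beta0 D2b er adm.
move=> /(le_trans h); rewrite pmulr_rle0; last first.
  by rewrite mulr_gt0 // lt_min gam0 invr_gt0.
move=> E2; have E0 : rnorm G y (grad y) = 0.
  by apply/eqP; rewrite -sqrf_eq0 eq_le E2 sqr_ge0.
move: ns; rewrite E0 mulr0 => ns.
have s0 : s = 0.
  apply/eqP; rewrite -(fnorm_eq0 (inner_sb G y) (inner_pd G y)).
  by rewrite eq_le ns sqrtr_ge0.
by rewrite s0 ret_zero.
Qed.

Definition noncritical z := grad z != 0 \/ exists s, D2 z s s < 0.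

(* Whichever kind of step is taken near a noncritical point, the quantity
   that drives it is bounded away from zero. *)
Lemma regime_lower z : noncritical z -> exists l1 e1,
  [/\ 0 < l1, 0 < e1 & \forall y \near z,
    if eigen_regime y then l1 <= `|lneg y| else e1 <= rnorm G y (grad y)].
Proof.
case=> [gz|[s Ds]].
  have [e e0 en] := grad_lower Rt Cg gz.
  (* In the eigenvector regime, [|lneg y| ^ 3 > e ^ 2 >= l1 >= l1 ^ 3]. *)
  pose l1 := Num.min 1 (e ^+ 2).
  have l10 : 0 < l1 by rewrite lt_min ltr01 exprn_gt0.
  exists l1, e; split=> //; apply: filterS en => y ey.
  case: ifP => // /andP[_ h].
  have l1e : l1 <= e ^+ 2 by rewrite ge_min lexx orbT.
  have l11 : l1 <= 1 by rewrite ge_min lexx.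
  have eE : e ^+ 2 <= rnorm G y (grad y) ^+ 2.
    by rewrite lerXn2r // nnegrE ?sqrtr_ge0 // ltW.
  rewrite leNgt; apply/negP => Ll.
  have : `|lneg y| ^+ 3 <= l1 ^+ 3.
    by rewrite lerXn2r ?nnegrE // ltW.
  have : l1 ^+ 3 <= l1 by rewrite -[leRHS]expr1; apply: ler_wiXn2l => //; exact: ltW.
  move: h l1e eE; lra.
have [l l0 ln] := lambda_upper G Cg Ds.
(* In the gradient regime, the squared gradient norm is at least [l ^ 3 >= e1 >= e1 ^ 2]. *)
pose e1 := Num.min 1 (l ^+ 3).
have e10 : 0 < e1 by rewrite lt_min ltr01 exprn_gt0.
exists l, e1; split=> //; apply: filterS ln => y ly.
have lam0 : lam y < 0 by apply: (le_lt_trans ly); rewrite oppr_lt0.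
have Ll : l <= `|lneg y| by rewrite lnegE // lerNr.
case: ifP => //; rewrite /eigen_regime lam0 /= => /negbT; rewrite -leNgt => h.
have e1l : e1 <= l ^+ 3 by rewrite ge_min lexx orbT.
have e11 : e1 <= 1 by rewrite ge_min lexx.
have lE : l ^+ 3 <= `|lneg y| ^+ 3 by rewrite lerXn2r ?nnegrE // ltW.
rewrite leNgt; apply/negP => Ee.
have : rnorm G y (grad y) ^+ 2 < e1 ^+ 2.
  by rewrite ltr_pXn2r ?nnegrE ?sqrtr_ge0 // ltW.
have : e1 ^+ 2 <= e1 by rewrite -[leRHS]expr1; apply: ler_wiXn2l => //; exact: ltW.
move: h lE e1l; lra.
Qed.

(** [gams] comes before [gamm] because a run determines the latter from the former; [kap] depends on
    [gamm] but is uniform over the neighbourhood. *)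
Lemma noncritical_progress z eta : 0 < eta < 1 -> noncritical z ->
  exists2 gams, 0 < gams & forall gamm, 0 < gamm -> exists2 kap, 0 < kap &
  \forall y \near z, forall gam s, 0 < gam -> admissible_step G Rt g y gam s ->
    (gam <= gams -> eta <= rho G Rt g y s) /\
    (gamm <= gam -> eta <= rho G Rt g y s -> g (Rt y s) <= g y - kap).
Proof.
move=> eta01 /regime_lower[l1 [e1 [l10 e10 nreg]]].
have /andP[eta0 eta1] := eta01.
have [beta beta0 nbeta] := hess_bound G Rt Cg z.
have [e2 e20 ne2] := grad_upper G Rt Cg z.
(* In the eigenvector regime the model decreases by at least [2^-1 * gam ^ 2 * |lneg y| ^ 3]; since
   [l1 <= |lneg y|], the error [eps * (gam * |lneg y|) ^ 2] is within the fraction [1 - eta] of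
   it. *)
pose eps := (1 - eta) * l1 / 2.
have eps0 : 0 < eps by rewrite divr_gt0 // mulr_gt0 // subr_gt0.
have [r r0 nr] := model_error G Rt Cg z eps0.
(* [r / beta] and [r / e2] confine the steps of the two regimes to length [r]; [beta^-1] makes
   [Num.min gam beta^-1] equal to [gam], and [l1^-1] absorbs the factor [l1] of [eps] in the
   gradient regime. *)
pose gams := Num.min (Num.min beta^-1 l1^-1) (Num.min (r / beta) (r / e2)).
have gams0 : 0 < gams by rewrite !lt_min !invr_gt0 beta0 l10 !divr_gt0.
exists gams => // gamm gamm0.
pose kap := eta * Num.min (2^-1 * gamm ^+ 2 * l1 ^+ 3)
  (2^-1 * Num.min gamm beta^-1 * e1 ^+ 2).
have kap0 : 0 < kap.
  by rewrite mulr_gt0 // lt_min !mulr_gt0 ?exprn_gt0 // lt_min gamm0 invr_gt0.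
exists kap => //.
apply: filterS (filterI (filterI nreg nbeta) (filterI ne2 nr)) => y [[reg D2b] [ye2 yr]].
move=> gam s gam0 adm.
have kap_le dec : Num.min (2^-1 * gamm ^+ 2 * l1 ^+ 3)
    (2^-1 * Num.min gamm beta^-1 * e1 ^+ 2) <= dec ->
    0 < dec -> model y 0 - model y s = dec -> eta <= rho G Rt g y s ->
    g (Rt y s) <= g y - kap.
  move=> h dec0 decE /(rho_decrease _); rewrite decE => /(_ dec0) H.
  by apply: (le_trans H); rewrite lerD2l lerN2 /kap ler_pM2l.
have [er|er] := boolP (eigen_regime y).
  rewrite er in reg.
  have [L0 Lb ns dec] := eigen_step_decrease gam0 D2b er adm.
  have dec0 : 0 < model y 0 - model y s.
    by apply: lt_le_trans dec; rewrite mulr_gt0 ?exprn_gt0 // mulr_gt0 // exprn_gt0.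
  split=> [gle|gge]; last first.
    apply: kap_le dec0 erefl; apply: le_trans dec; rewrite ge_min; apply/orP; left.
    apply: ler_pM; rewrite ?mulr_ge0 ?exprn_ge0 ?(ltW gamm0) ?(ltW l10) //.
      by rewrite ler_pM2l // lerXn2r // nnegrE ltW.
    by rewrite lerXn2r // nnegrE ltW.
  have sr : rnorm G y s <= r.
    apply: (le_trans ns); apply: (@le_trans _ _ (gam * beta)).
      by rewrite ler_pM2l.
    by rewrite -ler_pdivlMr //; apply: (le_trans gle); rewrite /gams !ge_min lexx !orbT.
  apply: (accepted_step eta01 dec0 (yr s sr)).
  apply: (@le_trans _ _ ((1 - eta) * (2^-1 * gam ^+ 2 * `|lneg y| ^+ 3))); last first.
    by rewrite ler_pM2l // subr_gt0.
  apply: (@le_trans _ _ (eps * (gam * `|lneg y|) ^+ 2)).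
    by rewrite ler_pM2l // lerXn2r // nnegrE ?sqrtr_ge0 // mulr_ge0 // ltW.
  have -> : (1 - eta) * (2^-1 * gam ^+ 2 * `|lneg y| ^+ 3) =
      (1 - eta) * `|lneg y| / 2 * (gam * `|lneg y|) ^+ 2 by field.
  by rewrite ler_wpM2r ?sqr_ge0 // /eps ler_pM2r // ler_pM2l // subr_gt0.
rewrite (negbTE er) in reg.
have [ns dec] := grad_step_decrease gam0 beta0 D2b er adm.
set E := rnorm G y (grad y) in reg ye2 ns dec *.
have E0 : 0 < E := lt_le_trans e10 reg.
have min0 : 0 < Num.min gam beta^-1 by rewrite lt_min gam0 invr_gt0.
have dec0 : 0 < model y 0 - model y s.
  by apply: lt_le_trans dec; rewrite mulr_gt0 ?exprn_gt0 // mulr_gt0.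
split=> [gle|gge]; last first.
  apply: kap_le dec0 erefl; apply: le_trans dec; rewrite ge_min; apply/orP; right.
  apply: ler_pM; rewrite ?mulr_ge0 ?exprn_ge0 ?(ltW e10) //.
  - by rewrite le_min (ltW gamm0) invr_ge0 ltW.
  - rewrite ler_pM2l // le_min !ge_min gge /= lexx orbT //.
  - by rewrite lerXn2r // nnegrE ltW.
have sr : rnorm G y s <= r.
  apply: (le_trans ns); apply: (@le_trans _ _ (gam * e2)).
    by rewrite ler_pM2l.
  by rewrite -ler_pdivlMr //; apply: (le_trans gle); rewrite /gams !ge_min lexx !orbT.
apply: (accepted_step eta01 dec0 (yr s sr)).
apply: (@le_trans _ _ ((1 - eta) * (2^-1 * Num.min gam beta^-1 * E ^+ 2))); last first.
  by rewrite ler_pM2l // subr_gt0.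
have -> : Num.min gam beta^-1 = gam.
  by rewrite min_l //; apply: (le_trans gle); rewrite /gams !ge_min lexx.
apply: (@le_trans _ _ (eps * (gam * E) ^+ 2)).
  by rewrite ler_pM2l // lerXn2r // nnegrE ?sqrtr_ge0 // mulr_ge0 // ltW.
have -> : eps * (gam * E) ^+ 2 = (1 - eta) * (2^-1 * gam * E ^+ 2) * (gam * l1).
  by rewrite /eps; field.
rewrite ler_piMr //.
  by rewrite !mulr_ge0 ?exprn_ge0 ?subr_ge0 // ltW.
rewrite -ler_pdivlMr // div1r; apply: (le_trans gle).
by rewrite /gams !ge_min lexx !orbT.
Qed.

End TrustRegionStep.

(** * Runs of the algorithm *)

Section Run.
Context {R : realType} {n : nat} {M : manifold R n} (G : riemannian_metric M).
Context (Rt : retraction M) (g : M -> R) (Cg : Ck_from 2 g).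
Context (Phi : M -> M) (gPhi : forall y, g (Phi y) = g y).
Context (gamc eta gamlo gamhi : R) (gamc01 : 0 < gamc < 1) (eta01 : 0 < eta < 1)
  (gamlo_gt0 : 0 < gamlo).
Context (yin : M) (y : nat -> M) (gam : nat -> R)
  (run : hooked_rtr_run G Rt g Phi gamc eta gamlo gamhi yin y gam).

Lemma run_gam_gt0 k : 0 < gam k.
Proof.
case: run => _ /andP[g0 _] step; elim: k => [|k IH]; first exact: lt_le_trans g0.
have [s _] := step k; case: ifP => _ [_].
  by move=> /andP[+ _]; exact: lt_le_trans.
by move=> ->; rewrite mulr_gt0 //; case/andP: gamc01.
Qed.

Lemma run_nonincreasing k : g (y k.+1) <= g (y k).
Proof.
case: run => _ _ /(_ k)[s adm]; case: ifP => [acc [-> _]|_ [-> _]] //.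
rewrite gPhi; case/andP: eta01 => eta0 _.
exact: (accepted_nonincreasing Cg eta0 (run_gam_gt0 k) adm acc).
Qed.

Lemma run_nonincreasing_le j k : (j <= k)%N -> g (y k) <= g (y j).
Proof.
move=> /subnKC <-; elim: (k - j)%N => [|i IH]; first by rewrite addn0.
by rewrite addnS; exact: le_trans (run_nonincreasing _) IH.
Qed.

(** The input is hooked too, and a rejection keeps the iterate; this confines the run to the bounded
    image of [Phi]. *)
Lemma run_hooked k : exists w, y k = Phi w.
Proof.
case: run => y0 _ step; elim: k => [|k [w IH]]; first by exists yin.
have [s _] := step k; case: ifP => _ [-> _]; first by exists (Rt (y k) s).
by exists w.
Qed.

(* Every visit near a noncritical [z] is followed, after finitely many rejected
   steps at the same iterate, by a decrease of at least [kap]. *)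
Lemma run_cluster_critical z : cluster (y @ \oo) z -> two_critical g z.
Proof.
move=> clz; apply: contrapT => ncrit.
have nc : noncritical G Rt g z.
  apply: contrapT => /not_orP[/negP/negPn/eqP gz /forallNP D2z].
  apply: ncrit; apply: (two_critical_hess Cg gz) => s.
  by rewrite leNgt; apply/negP; exact: D2z.
have [gams gams0 prog] := noncritical_progress Cg eta01 nc.
have /andP[gamc0 gamc1] := gamc01; have /andP[eta0 _] := eta01.
pose gamm := Num.min gamlo (gamc * gams).
have gamm0 : 0 < gamm by rewrite lt_min gamlo_gt0 mulr_gt0.
have [kap kap0 nz] := prog _ gamm0.
pose N := [set q | forall gam s, 0 < gam -> admissible_step G Rt g q gam s ->
    (gam <= gams -> eta <= rho G Rt g q s) /\
    (gamm <= gam -> eta <= rho G Rt g q s -> g (Rt q s) <= g q - kap)].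
have [_ gam_init step] := run.
have visit k (A : set M) : nbhs z A -> exists2 j, (k <= j)%N & A (y j).
  move=> zA; have Fk : (y @ \oo) [set y j | j in [set j | (k <= j)%N]].
    by exists k => // j kj; exists j.
  by have [_ [[j kj <-] Aj]] := clz _ _ Fk zA; exists j.
(* Either the parameter was just chosen, hence at least [gamlo], or the previous step was rejected
   at this same point, so it exceeded [gams] before being multiplied by [gamc]. *)
have gam_lower k : N (y k) -> gamm <= gam k.
  case: k => [_|k].
    by case/andP: gam_init => h _; apply: le_trans h; rewrite ge_min lexx.
  have [s adm] := step k; case: ifP => [_ [_ /andP[h _]] _|rej [-> ->] Nk].
    by apply: le_trans h; rewrite ge_min lexx.
  have [h _] := Nk _ _ (run_gam_gt0 k) adm.
  apply: (@le_trans _ _ (gamc * gams)); first by rewrite ge_min lexx orbT.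
  rewrite ler_pM2l // leNgt; apply/negP => /ltW/h; by rewrite rej.
have drop k : N (y k) -> exists2 j, (k <= j)%N & g (y j.+1) <= g (y k) - kap.
  move=> Nk; apply: contrapT => nj.
  (* If no later step achieved the decrease, all would be rejected and [gam] would tend to 0,
     against [gam_lower]. *)
  have stay j : y (k + j)%N = y k /\ gam (k + j)%N = gamc ^+ j * gam k.
    elim: j => [|j [yj gj]]; first by rewrite addn0 expr0 mul1r.
    rewrite addnS; have [s adm] := step (k + j)%N.
    case: ifP => [acc [ys _]|_ [-> ->]].
      exfalso; apply: nj; exists (k + j)%N; first exact: leq_addr.
      have Nkj : N (y (k + j)%N) by rewrite yj.
      have [_ h] := Nkj _ _ (run_gam_gt0 _) adm.
      by rewrite ys gPhi -yj; apply: h acc; exact: gam_lower.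
    by rewrite yj gj exprS mulrA.
  have : gamc ^+ j * gam k @[j --> \oo] --> (0 : R).
    rewrite -[X in _ --> X](mul0r (gam k)); apply: cvgM; last exact: cvg_cst.
    by apply: cvg_expr; rewrite ger0_norm // ltW.
  move=> /cvgrPdist_lt/(_ _ gamm0)[j _ /(_ j (leqnn j))] /=.
  have [yj gj] := stay j.
  rewrite -gj sub0r normrN ger0_norm ?ltW ?run_gam_gt0 // ltNge => /negP; apply.
  by apply: gam_lower; rewrite yj.
have decr (m : nat) : exists k, g (y k) <= g (y 0%N) - m%:R * kap.
  elim: m => [|m [k IH]]; first by exists 0%N; rewrite mul0r subr0.
  have [j kj Nj] := visit k _ nz; have [i _ ij] := drop j Nj.
  exists i.+1; apply: (le_trans ij); have := run_nonincreasing_le kj.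
  by move: IH; rewrite -natr1 mulrDl mul1r; lra.
(* By continuity the bound holds at visits near [z], which recur forever; monotonicity extends it to
   all iterates. *)
have lower k : g z - 1 <= g (y k).
  have cz : \forall q \near z, g z - 1 <= g q.
    have cg : {for z, continuous g} := Ck_from_continuous Cg.
    by apply: (cvgr_ge _ cg); rewrite ltrBlDr ltrDl.
  by have [j kj gj] := visit k _ cz; exact: le_trans gj (run_nonincreasing_le kj).
pose m := Num.truncn ((g (y 0%N) - g z + 1) / kap).
have [k gk] := decr m.+1; have := le_trans (lower k) gk.
have := truncnS_gt ((g (y 0%N) - g z + 1) / kap); rewrite ltr_pdivrMr // -/m.
lra.
Qed.

End Run.

Theorem corollary3p8 (R : realType) (n m : nat) (M : manifold R n)
    (G : riemannian_metric M) (Gcomplete : rcomplete G)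
    (phi : M -> 'rV[R]_m) (phi_smooth : smooth_from phi)
    (Phi : M -> M) (Phi_rebalancing : rebalancing G phi Phi)
    (U : set 'rV[R]_m) (Uopen : open U) (rangeU : range phi `<=` U)
    (f : 'rV[R]_m -> R^o) (f_C3 : Ck_on 3 U f)
    (x0 : 'rV[R]_m) (x0X : range phi x0)
    (sublevel_bounded : ebounded [set x | range phi x /\ f x <= f x0])
    (Rt : retraction M)
    (gamc eta gamlo gamhi : R)
    (gamc01 : 0 < gamc < 1) (eta01 : 0 < eta < 1)
    (gamlo_gt0 : 0 < gamlo) (gamlo_le : gamlo <= gamhi)
    (yin : M) (yin_x0 : phi yin = x0)
    (y : nat -> M) (gam : nat -> R)
    (run : hooked_rtr_run G Rt (f \o phi) Phi gamc eta gamlo gamhi yin y gam) :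
  (exists z : M, cluster (y @ \oo) z) /\
  (forall z : M, cluster (y @ \oo) z -> two_critical (f \o phi) z).
Proof.
have Cg : Ck_from 2 (f \o phi).
  exact: Ck_from_smooth_comp phi_smooth Uopen rangeU (Ck_onW f_C3).
have [phiPhi Phi_bounded] := Phi_rebalancing.
have gPhi q : (f \o phi) (Phi q) = (f \o phi) q by rewrite /= phiPhi.
split; last first.
  exact: (run_cluster_critical Cg gPhi gamc01 eta01 gamlo_gt0 run).
have y0E : (f \o phi) (y 0%N) = f x0.
  by case: run => -> _ _; rewrite gPhi /= yin_x0.
apply: (rbounded_cluster Gcomplete
  (Phi_bounded [set x | range phi x /\ f x <= f x0] _ sublevel_bounded)).
  by move=> x [].
(* The hook preserves [phi], so the sublevel bound on the iterate [Phi w] is a bound on [w], which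
   therefore lies over the sublevel set. *)
move=> k; have [w wE] := run_hooked run k; exists w => //=.
split; first by exists w.
have := run_nonincreasing_le Cg gPhi gamc01 eta01 gamlo_gt0 run (leq0n k).
by rewrite y0E wE gPhi.
Qed.
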